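(* Let $\alpha\in(0,1)$ be irrational with principal convergents $p_i/q_i$, and let $\delta_i=|\alpha-p_i/q_i|$, $\beta_i=\delta_i^{-1}$. Let $n$ be a positive integer with $n>1/\alpha$ and $n>1/(1-\alpha)$, and let $\lambda=\mathrm{sh}(w(n,\alpha))$, with conjugate partition $\lambda'$. Let $h\ge 0$ be such that $\beta_{2h}\le n<\beta_{2h+2}$, and set $$*=\begin{cases}0 & \text{if } \beta_{2h}\le n<\beta_{2h+1},\\ 2 & \text{if } \beta_{2h+1}\le n<\beta_{2h+2},\end{cases}$$ $$x_0:=\frac{1-n\delta_{2h+1}}{q_{2h+*}(\delta_{2h+*}-\delta_{2h+1})},\qquad y_0:=\frac{1-n\delta_{2h+*}}{q_{2h+1}(\delta_{2h+1}-\delta_{2h+*})}.$$ Then for all integers $k$ with $1\le k\le y_0-1$, $$\left|\lambda_k-q_{2h+1}(1+n\delta_{2h+1})+2kq_{2h+1}^2\delta_{2h+1}\right|<4+2q_{2h+1}^2\delta_{2h+1}<6,$$ and for all integers $k$ with $1\le k\le x_0-1$, $$\left|\lambda'_k-q_{2h+*}(1+n\delta_{2h+*})+2kq_{2h+*}^2\delta_{2h+*}\right|<4+2q_{2h+*}^2\delta_{2h+*}<6.$$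
   Context: The principal convergents of $\alpha=[a_0;a_1,a_2,\ldots]$ (simple continued fraction) are the reduced fractions $p_k/q_k=[a_0;a_1,\ldots,a_k]$, $k\ge 0$; since $\alpha\in(0,1)$, $a_0=0$ and $p_0/q_0=0/1$. Let $f(i)=\alpha i-\lfloor \alpha i\rfloor$. The permutation $w(n,\alpha)\in S_n$ is the sorting permutation of $(f(1),\ldots,f(n))$, i.e. the permutation $w$ with $f(w(1))<\cdots<f(w(n))$ (the values are distinct as $\alpha$ is irrational). For a permutation $w\in S_n$, $\mathrm{sh}(w)$ denotes the common shape of the two standard Young tableaux associated with $w$ by Schensted insertion (the Robinson–Schensted correspondence), viewed as a partition $\lambda=(\lambda_1\ge\lambda_2\ge\cdots)$ of $n$. Equivalently (Greene's theorem), $\lambda_1+\cdots+\lambda_k$ is the maximal size of a union of $k$ increasing subsequences of $w$, and $\lambda'_1+\cdots+\lambda'_k$ is the maximal size of a union of $k$ decreasing subsequences. Here $\lambda'$ is the conjugate partition of $\lambda$. Parts beyond the last nonzero one are taken to be $0$. *)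

(* Defs.v *)
From HB Require Import structures.
From mathcomp Require Import all_boot all_order all_algebra all_fingroup.
From mathcomp Require Import boolp classical_sets reals.
From mathcomp Require Import lra.

Set Implicit Arguments.
Unset Strict Implicit.
Unset Printing Implicit Defensive.

Import Order.TTheory GRing.Theory Num.Theory.

Local Open Scope ring_scope.

Fixpoint complete_quotient (R : realType) (alpha : R) (k : nat) : R :=
  if k is k'.+1 then
    let x := complete_quotient alpha k' in (x - (Num.floor x)%:~R)^-1
  else alpha.

Definition partial_quotient (R : realType) (alpha : R) (k : nat) : int :=
  Num.floor (complete_quotient alpha k).

(* [:: a0; ...; ak] is sent to a0 + 1 / (a1 + 1 / (... + 1 / ak)); the value on
   the empty sequence is irrelevant. *)
Fixpoint cfrac (s : seq int) : rat :=
  match s with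
  | [::] => 0
  | [:: a] => a%:~R
  | a :: s' => a%:~R + (cfrac s')^-1
  end.

Definition convergent (R : realType) (alpha : R) (k : nat) : rat :=
  cfrac (mkseq (partial_quotient alpha) k.+1).

(* [numq] and [denq] are coprime with [0 < denq], so that
   [conv_num alpha k / conv_den alpha k] is the k-th convergent in reduced
   form. *)
Definition conv_num (R : realType) (alpha : R) (k : nat) : R :=
  (numq (convergent alpha k))%:~R.

Definition conv_den (R : realType) (alpha : R) (k : nat) : R :=
  (denq (convergent alpha k))%:~R.

Definition conv_err (R : realType) (alpha : R) (k : nat) : R :=
  `|alpha - conv_num alpha k / conv_den alpha k|.

Definition fracpart (R : realType) (alpha : R) (i : nat) : R :=
  alpha * i%:R - (Num.floor (alpha * i%:R))%:~R.

(* [i : 'I_n] stands for the integer [i.+1] of {1, ..., n}. *)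
Definition sorts (R : realType) (n : nat) (alpha : R) (w : 'S_n) : bool :=
  [forall i : 'I_n, forall j : 'I_n,
     (i < j)%N ==> (fracpart alpha (w i).+1 < fracpart alpha (w j).+1)].

(* The default value [1] is not used when [alpha] is irrational: see
   [sorting_permP] and [sorts_uniq]. *)
Definition sorting_perm (R : realType) (n : nat) (alpha : R) : 'S_n :=
  odflt 1%g [pick w : 'S_n | sorts alpha w].

Lemma fracpart_inj (R : realType) (alpha : R) :
  irrational alpha -> injective (fracpart alpha).
Proof.
move=> irr i j; rewrite /fracpart => eq_ij.
apply/eqP/negPn/negP => ne_ij; apply: irr => /=.
pose z := Num.floor (alpha * i%:R) - Num.floor (alpha * j%:R).
pose d : int := i%:Z - j%:Z.
have d0 : (d%:~R : R) != 0 by rewrite intr_eq0 subr_eq0 eqz_nat.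
exists (z%:~R / d%:~R) => //.
rewrite fmorph_div/= !ratr_int; apply: (canLR (mulfK d0)).
rewrite /z /d !rmorphB/= -!pmulrn mulrBr.
by move: eq_ij; set a := (Num.floor _)%:~R; set b := (Num.floor _)%:~R; lra.
Qed.

Section SortingPerm.

Variables (R : realType) (n : nat) (alpha : R).

Let ltf := [rel x y : 'I_n | fracpart alpha x.+1 < fracpart alpha y.+1].
Let lef := [rel x y : 'I_n | fracpart alpha x.+1 <= fracpart alpha y.+1].

Let ltf_trans : transitive ltf.
Proof. by move=> y x z /=; apply: lt_trans. Qed.

Let sortsE (w : 'S_n) : sorts alpha w = sorted ltf [seq w i | i <- enum 'I_n].
Proof.
rewrite sorted_map.
apply/idP/idP => [/forallP sw | sw].
  have /= : sorted (relpre val ltn) (enum 'I_n).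
    by rewrite -sorted_map val_enum_ord iota_ltn_sorted.
  apply: sub_sorted => i j /= ij.
  by have /forallP/(_ j)/implyP/(_ ij) := sw i.
apply/forallP => i; apply/forallP => j; apply/implyP => ij.
have tr : transitive (relpre w ltf) by move=> y x z /=; apply: lt_trans.
have := sorted_ltn_nth tr i sw (nat_of_ord i) (nat_of_ord j).
by rewrite !inE/= size_enum_ord !nth_ord_enum; apply.
Qed.

Lemma sorting_permP : irrational alpha -> sorts alpha (sorting_perm n alpha).
Proof.
move=> irr; rewrite /sorting_perm; case: pickP => //= no.
pose s := sort lef (enum 'I_n).
have szs : size s = n by rewrite size_sort size_enum_ord.
have us : uniq s by rewrite sort_uniq enum_uniq.
have inj : injective (fun i : 'I_n => nth i s i).
  move=> i j /eqP; rewrite (set_nth_default i j) ?szs ?ltn_ord//.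
  by rewrite nth_uniq ?szs ?ltn_ord// => /eqP/val_inj.
have /negP[] := no (perm inj); rewrite sortsE.
have -> : [seq perm inj i | i <- enum 'I_n] = s.
  case: (posnP n) => [n0|n_gt0].
    by apply: etrans (esym (size0nil (etrans szs n0))); apply/size0nil;
      rewrite size_map size_enum_ord.
  pose x0 := Ordinal n_gt0.
  apply: (@eq_from_nth _ x0) => [|i]; first by rewrite size_map size_enum_ord.
  rewrite size_map size_enum_ord => lt_in.
  rewrite (nth_map x0) ?size_enum_ord// permE nth_enum_ord//.
  by apply: set_nth_default; rewrite szs.
have ss : sorted lef s by apply: sort_sorted => x y /=; apply: le_total.
have : sorted [rel x y | (x != y) && lef x y] s.
  rewrite sorted_pairwise; last first.
    move=> y x z /= /andP[xy lxy] /andP[yz lyz].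
    rewrite (le_trans lxy lyz) andbT; apply: contraNneq xy => xz.
    apply/eqP/val_inj/succn_inj/(fracpart_inj irr)/le_anti.
    by rewrite lxy xz lyz.
  rewrite (pairwise_relI (fun x y : 'I_n => x != y) lef) -uniq_pairwise us.
  by rewrite -sorted_pairwise// => y x z /=; apply: le_trans.
apply: sub_sorted => x y /= /andP[xy lxy]; rewrite lt_neqAle lxy andbT.
by apply: contraNneq xy => /(fracpart_inj irr)/succn_inj/val_inj ->.
Qed.

Lemma sorts_uniq (w1 w2 : 'S_n) : sorts alpha w1 -> sorts alpha w2 -> w1 = w2.
Proof.
rewrite !sortsE => s1 s2; apply/permP => i.
have : [seq w1 i | i <- enum 'I_n] = [seq w2 i | i <- enum 'I_n].
  apply: (irr_sorted_eq ltf_trans _ s1 s2) => [x|x]; first exact: ltxx.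
  have mem (w : 'S_n) : x \in [seq w i | i <- enum 'I_n].
    by apply/mapP; exists ((w^-1)%g x); rewrite ?mem_enum// permKV.
  by rewrite !mem.
by move/eq_in_map; apply; rewrite mem_enum.
Qed.

End SortingPerm.

(* Rows are listed from the first (longest) to the last.  Inserting [x] in a row
   replaces the leftmost entry greater than [x], which is inserted in the next
   row, or appends [x] if there is no such entry. *)
Fixpoint schensted_insert (t : seq (seq nat)) (x : nat) : seq (seq nat) :=
  match t with
  | [::] => [:: [:: x]]
  | r :: t' =>
      let i := find (fun y => (x < y)%N) r in
      if (i < size r)%N then
        set_nth 0%N r i x :: schensted_insert t' (nth 0%N r i)
      else rcons r x :: t'
  end.

(* The insertion tableau P; the recording tableau Q has the same shape by
   construction. *)
Definition schensted (s : seq nat) : seq (seq nat) :=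
  foldl schensted_insert [::] s.

Definition perm_word (n : nat) (w : 'S_n) : seq nat :=
  [seq (w i).+1 | i <- enum 'I_n].

Definition sh (n : nat) (w : 'S_n) : seq nat :=
  shape (schensted (perm_word w)).

Definition conj_part (lambda : seq nat) : seq nat :=
  mkseq (fun j => count (fun r => (j < r)%N) lambda) (head 0%N lambda).

(* The k-th part, with parts numbered from 1. *)
Definition part (lambda : seq nat) (k : nat) : nat := nth 0%N lambda k.-1.

(* Main.v *)
Require Import Defs.
From HB Require Import structures.
From mathcomp Require Import all_boot all_order all_algebra all_fingroup.
From mathcomp Require Import boolp classical_sets reals.
From mathcomp Require Import zify ring lra.

(** The points [(i, f i)], [1 <= i <= n], are the points that a rectangle of
    width [n] and height [1] cuts out of the lattice spanned by
    [e_a = (q_a, q_a delta_a)] and [e_b = (q_b, - q_b delta_b)]: consecutive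
    convergents have determinant [1], and even ones lie below [alpha] while odd
    ones lie above.  Reading the word of [w] is reading the points by increasing
    height, so an increasing subsequence is a chain of points going up to the
    right and a decreasing one a chain going down to the right.

    Write a point as [x e_a + y e_b].  The points with a given [x] form a
    decreasing chain, a column; let [c_x] be its length.  An increasing chain
    meets a column at most once, so [k] of them cover at most
    [sum_x min (k, c_x)] points.  For [k < y0] this is attained.  The
    parallelogram with sides [x0 e_a] and [y0 e_b] is inscribed in the rectangle
    with one vertex on each side, so the lower and upper ends of the columns are
    a convex and a concave piecewise linear function of [x], with slopes
    [- sigma, rho] and [rho, - sigma] where
    [sigma = q_a / q_b < 1 < rho = (q_a delta_a) / (q_b delta_b)] when [* = 0].
    Some straight line of slope at most [(rho - sigma) / 2] stays between the
    lower end and the upper end minus [k], whichever of the two is greater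
    ([strip_line]), so a window of [k] consecutive values of [y] resting on that
    line either lies in the column or contains it.  Points with the same rank in their windows form an
    increasing chain, because the window climbs by less than [rho] per column
    ([ceil_slope]).  Hence [lambda_1 + .. + lambda_k = sum_x min (k, c_x)], and
    [lambda_k] is the number of columns with at least [k] points
    ([fibre_diff]).  These columns are the integers of an interval whose ends
    are known up to [q_b ^ 2 delta_b], which gives
    [q_b (1 + n delta_b) - 2 k q_b ^ 2 delta_b] with an error at most
    [1 + 2 q_b ^ 2 delta_b] ([part_estimate]).

    Of Greene's theorem only two inequalities are used: [k] increasing
    subsequences have total length at most [lambda_1 + .. + lambda_k], and [k]
    decreasing ones at most [lambda'_1 + .. + lambda'_k] ([greene_inc],
    [greene_dec]).  Applied to the longest columns, the second one bounds
    [lambda_1 + .. + lambda_k] from above ([fibre_sum_ub]).  Both are proved by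
    following a family of disjoint chains through each bump of the insertion
    ([bump_transfers_inc], [bump_transfers_dec]) up to the reading word of the
    tableau, where rows and columns are chains.

    The estimate of [lambda'] and the case [* = 2] are the same statement after
    a reflection of the plane that permutes the two axes and the two lattice
    directions, so [part_estimate] is about an abstract rectangle. *)

Set Implicit Arguments.
Unset Strict Implicit.
Unset Printing Implicit Defensive.

(** * Families of disjoint chains and the bumping of one row *)

Lemma pairwise_flatten (T : Type) (r : rel T) (L : seq (seq T)) :
  pairwise r (flatten L) = all (pairwise r) L && pairwise (allrel r) L.
Proof.
have allrel_flatten a M : allrel r a (flatten M) = all (allrel r a) M.
  by elim: M => [|b M IH] /=; rewrite ?allrel0r// allrel_catr IH.
elim: L => //= a L IH; rewrite pairwise_cat IH allrel_flatten.
by case: (pairwise r a); case: (all (allrel r a) L) => //=; rewrite andbF.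
Qed.

Lemma sub_pairwise_mem (T : eqType) (r r' : rel T) (s : seq T) :
  (forall z z', z \in s -> z' \in s -> r z z' -> r' z z') ->
  pairwise r s -> pairwise r' s.
Proof. by move=> H; apply: (sub_in_pairwise (P := mem s)) => //; apply/allP. Qed.

(** A family of [k] disjoint [e]-chains is encoded by a colour for each letter;
    the letters outside the family are those of colour [k] or more.  This keeps
    chains as plain functions on letters, so that exchanging the tails of two
    chains is a renaming of colours. *)
Definition colouring (e : rel nat) (k : nat) (c : nat -> nat) (s : seq nat) :=
  pairwise (fun z z' => (c z < k) && (c z == c z') ==> e z z') s.

Definition transfers (e : rel nat) (s s' : seq nat) :=
  forall k c, colouring e k c s -> exists2 c',
    colouring e k c' s' & count (fun z => c' z < k) s' = count (fun z => c z < k) s.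

Lemma sorted_has_min (P : pred nat) (s : seq nat) : sorted ltn s -> has P s ->
  exists f, [/\ f \in s, P f & forall z, z \in s -> P z -> f <= z].
Proof.
elim: s => //= a s IH path_s; case: (boolP (P a)) => [Pa _|Pa /= hs].
  exists a; split; rewrite ?inE ?eqxx // => z; rewrite inE => /predU1P[->//|zs _].
  by move: path_s; rewrite (path_sortedE ltn_trans) => /andP[/allP/(_ z zs)/ltnW].
have [f [fs Pf fmin]] := IH (path_sorted path_s) hs.
exists f; split; rewrite ?inE ?fs ?orbT // => z; rewrite inE => /predU1P[->|]; last exact: fmin.
by rewrite (negPf Pa).
Qed.

Lemma pairwise_mem2 (T : eqType) (r : rel T) (s : seq T) z z' : pairwise r s ->
  z \in s -> z' \in s -> z != z' -> r z z' || r z' z.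
Proof.
elim: s => //= a s IH /andP[/allP ha hs]; rewrite !inE.
case/predU1P=> [->|zs] /predU1P[->|zs'] neq; first by rewrite eqxx in neq.
- by rewrite ha.
- by rewrite (ha _ zs) orbT.
- exact: IH.
Qed.

Lemma count_change_one (T : eqType) (p p' : pred T) (s : seq T) w :
  uniq s -> w \in s -> {in s, forall z, z != w -> p' z = p z} ->
  (count p' s + p w = count p s + p' w)%N.
Proof.
move=> us ws same; have /seq.permP perm_s := perm_to_rem ws; rewrite !perm_s /=.
have -> : count p' (rem w s) = count p (rem w s).
  by apply: eq_in_count => z; rewrite mem_rem_uniq // inE => /andP[? ?]; apply: same.
by rewrite addnC [(p' w + _)%N]addnC addnA.
Qed.

(** Row insertion of [x] in the row [u y v], where [y] is the leftmost entry
    greater than [x], turns the factor [u y v x] of the reading word into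
    [y u x v].  The words [A] and [B] are the rest of the reading word, so a
    bump in any row is covered. *)
Section Bump.
Variables (A u v B : seq nat) (x y : nat).
Let old := flatten [:: A; u; [:: y]; v; [:: x]; B].
Let new := flatten [:: A; [:: y]; u; [:: x]; v; B].

Lemma bump_perm : perm_eq old new.
Proof.
rewrite /old /new /= !cats0 perm_cat2l.
by apply/seq.permP => p; rewrite !count_cat /= !count_cat /= !count_cat /=; lia.
Qed.

Hypotheses (u_inc : sorted ltn u) (v_inc : sorted ltn v).
Hypotheses (ux : forall z, z \in u -> z < x) (xy : x < y)
           (yv : forall z, z \in v -> y < z).
Hypothesis old_uniq : uniq old.

Lemma before_old e k c : colouring e k c old ->
  [/\ colouring e k c A, colouring e k c u, colouring e k c v & colouring e k c B] /\
  (forall i j z z', (j < 6) && (i < j) ->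
   z \in nth [::] [:: A; u; [:: y]; v; [:: x]; B] i ->
   z' \in nth [::] [:: A; u; [:: y]; v; [:: x]; B] j ->
   c z < k -> c z = c z' -> e z z').
Proof.
rewrite /colouring /old pairwise_flatten => /andP[/and4P[cA cu _ /and4P[cv _ cB _]] H].
split => //.
move=> i j z z' /andP[ltj ltij] zi zj ltk eqc.
move/(pairwiseP [::])/(_ i j _ _ ltij): H.
rewrite !inE /= => /(_ (ltn_trans ltij ltj) ltj)/allrelP/(_ z z' zi zj).
by rewrite ltk eqc eqxx.
Qed.

(** Within a segment the order of the letters is the same before and after the
    bump, so only pairs from different segments have to be examined. *)
Lemma colouring_new e k c :
  [/\ colouring e k c A, colouring e k c u, colouring e k c v & colouring e k c B] ->
  (forall i j z z', (j < 6) && (i < j) ->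
   z \in nth [::] [:: A; [:: y]; u; [:: x]; v; B] i ->
   z' \in nth [::] [:: A; [:: y]; u; [:: x]; v; B] j ->
   c z < k -> c z = c z' -> e z z') -> colouring e k c new.
Proof.
move=> [cA cu cv cB] H; rewrite /colouring /new pairwise_flatten.
apply/andP; split; first by apply/and5P; split => //; rewrite /= ?andbT; apply/andP.
apply/(pairwiseP [::]) => i j lti ltj ltij; apply/allrelP => z z' zi zj.
apply/implyP => /andP[ltk /eqP eqc].
by apply: (H i j) => //; rewrite ltij andbT.
Qed.


Lemma colouring_swap e k c c' i j s : i < k -> j < k ->
  {in s, forall z, c' z = if c z == i then j else if c z == j then i else c z} ->
  colouring e k c s -> colouring e k c' s.
Proof.
move=> ik jk c'E; apply: sub_pairwise_mem => z z' zs zs' /implyP H.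
apply/implyP => /andP[lt /eqP eq]; apply: H.
move: lt eq; rewrite !c'E //.
by case: (c z =P i); case: (c z =P j); case: (c z' =P i); case: (c z' =P j); lia.
Qed.


Lemma colouring_eq_in e k c c' s :
  {in s, c' =1 c} -> colouring e k c s -> colouring e k c' s.
Proof.
move=> c'E; apply: sub_pairwise_mem => z z' zs zs' /implyP H.
by apply/implyP; rewrite !c'E.
Qed.

(** The letters are distinct, so a colouring can be modified segment by
    segment. *)
Lemma segment_index : exists seg : nat -> nat, forall i z,
  z \in nth [::] [:: A; u; [:: y]; v; [:: x]; B] i -> seg z = i.
Proof.
pose L := [:: A; u; [:: y]; v; [:: x]; B].
exists (fun z => find (fun s => z \in s) L) => i z zi.
have lti : i < size L by rewrite ltnNge; apply/negP => le; rewrite nth_default in zi.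
have hasL : has (fun s => z \in s) L by apply/hasP; exists (nth [::] L i); rewrite ?mem_nth.
have zf := nth_find [::] hasL; move: hasL; rewrite has_find => ltf.
move: zf ltf; set f := find _ _ => zf ltf.
move: old_uniq; rewrite uniq_pairwise pairwise_flatten => /andP[_ /(pairwiseP [::]) H].
case: (ltngtP f i) => // lt.
  by have /allrelP/(_ z z zf zi) := H f i ltf lti lt; rewrite /= eqxx.
by have /allrelP/(_ z z zi zf) := H i f lti ltf lt; rewrite /= eqxx.
Qed.

(** The only pairs that the bump puts out of order for increasing chains are
    those of [y] with letters of [u].  If a chain uses both, it can trade [y]
    for [x] when [x] is free.  When [x] lies on another chain, the two chains
    exchange their tails: all their letters in [u], then [x] and what followed
    it, continue the head of the chain owning the smallest of these letters of
    [u], and [y] with what followed it continues the other head. *)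
Lemma bump_transfers_inc : transfers ltn old new.
Proof.
move=> k c /before_old[[cA cu cv cB] H].
have [seg segE] := segment_index.
have sA z : z \in A -> seg z = 0 by exact: (segE 0).
have su z : z \in u -> seg z = 1 by exact: (segE 1).
have sy : seg y = 2 by apply: (segE 2); rewrite inE.
have sv z : z \in v -> seg z = 3 by exact: (segE 3).
have sx : seg x = 4 by apply: (segE 4); rewrite inE.
have sB z : z \in B -> seg z = 5 by exact: (segE 5).
have count_new c' : count (fun z => c' z < k) new = count (fun z => c' z < k) old.
  by apply/esym/seq.permP/bump_perm.

have uy z : z \in u -> z < y by move=> /ux zx; apply: ltn_trans xy.
case: (boolP ((c y < k) && has (fun z => c z == c y) u)) => [/andP[yk uy_col]|no_clash]; last first.
  exists c => //; apply: colouring_new => // i j z z'.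
  (* the pairs of segments, in the order of the new word *)
  case: i => [|[|[|[|[|[|i]]]]]]; case: j => [|[|[|[|[|[|j]]]]]] //= _.
  - by apply: (H 0 2).
  - by apply: (H 0 1).
  - by apply: (H 0 4).
  - by apply: (H 0 3).
  - by apply: (H 0 5).
  - rewrite inE => /eqP-> z'u yk eqc; case/negP: no_clash; rewrite yk.
    by apply/hasP; exists z' => //; rewrite eqc.
  - by apply: (H 2 4).
  - by apply: (H 2 3).
  - by apply: (H 2 5).
  - by apply: (H 1 4).
  - by apply: (H 1 3).
  - by apply: (H 1 5).
  - by rewrite inE => /eqP-> /yv yz'; rewrite (ltn_trans xy).
  - by apply: (H 4 5).
  - by apply: (H 3 5).
have xyc : c x < k -> c x != c y.
  move=> xk; apply/eqP => eqc; have := H 2 4 y x isT; rewrite !inE /= -eqc.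
  by move=> /(_ _ _ xk erefl); rewrite !eqxx ltnNge (ltnW xy) => /(_ isT isT).
(* [x] is free: it takes the colour of [y] *)
case: (ltnP (c x) k) => xk; last first.
  exists (fun z => if seg z == 2 then c x else if seg z == 4 then c y else c z).
    apply: colouring_new => [|i j z z'].
      by split; [move: cA | move: cu | move: cv | move: cB];
        apply: colouring_eq_in => z zs; rewrite ?(sA z zs) ?(su z zs) ?(sv z zs) ?(sB z zs).
    case: i => [|[|[|[|[|[|i]]]]]]; case: j => [|[|[|[|[|[|j]]]]]] //= _;
      rewrite ?inE => zi zj;
      rewrite ?(sA z zi) ?(su z zi) ?(sv z zi) ?(sB z zi)
        ?(sA z' zj) ?(su z' zj) ?(sv z' zj) ?(sB z' zj)
        ?(eqP zi) ?(eqP zj) ?sx ?sy /=.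
    + by move=> zk eqc; apply: ltn_trans xy; apply: (H 0 4) => //; rewrite inE.
    + exact: (H 0 1).
    + by move=> zk eqc; have [w wu /eqP eqw] := hasP uy_col; apply: ltn_trans (ux wu);
        apply: (H 0 1) => //; rewrite eqc.
    + exact: (H 0 3).
    + exact: (H 0 5).
    + by move=> xk'; rewrite ltnNge xk in xk'.
    + by move=> xk'; rewrite ltnNge xk in xk'.
    + by move=> xk'; rewrite ltnNge xk in xk'.
    + by move=> xk'; rewrite ltnNge xk in xk'.
    + by rewrite ux.
    + by move=> _ _; apply: ltn_trans (uy _ zi) (yv zj).
    + exact: (H 1 5).
    + by move=> _ _; apply: ltn_trans xy (yv zj).
    + by move=> zk eqc; apply: ltn_trans xy _; apply: (H 2 5) => //; rewrite inE.
    + exact: (H 3 5).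
  rewrite count_new /old /= cats0 !count_cat /= !count_cat /=.
  have cnt i s : (forall z, z \in s -> seg z = i) -> i != 2 -> i != 4 ->
      count (fun z => (if seg z == 2 then c x else if seg z == 4 then c y else c z) < k) s
      = count (fun z => c z < k) s.
    by move=> si /negPf i2 /negPf i4; apply: eq_in_count => z /si ->; rewrite i2 i4.
  rewrite (cnt 0) // (cnt 1) // (cnt 3) // (cnt 5) // sx sy /=.
  by rewrite yk ltnNge xk !add0n (addnCA 1).
have {}xyc := xyc xk.
have xv z : z \in v -> c z < k -> c z != c x.
  move=> zv zk; apply/eqP => eqc; have := H 3 4 z x isT zv.
  by rewrite inE eqxx => /(_ isT zk eqc) /= lt; have := ltn_trans (ltn_trans lt xy) (yv zv); rewrite ltnn.
(* [f] is the smallest letter of [u] on the two chains and [i] the chain owning it *)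
pose P := fun z => (c z == c y) || (c z == c x).
have hasPu : has P u by apply: sub_has uy_col => z /=; rewrite /P => ->.
have [f [fu Pf fmin]] := sorted_has_min u_inc hasPu.
pose i := c f; pose j := if i == c y then c x else c y.
have ij : (i = c y /\ j = c x) \/ (i = c x /\ j = c y).
  rewrite /j; case: eqP => eqi; [by left|right]; split=> //.
  by move: Pf; rewrite /P -/i => /orP[]/eqP.
have [ik jk] : i < k /\ j < k by case: ij => -[-> ->].
have neij : i != j by case: ij => -[-> ->]; rewrite 1?eq_sym // eq_sym.
have Pij z : c z = i \/ c z = j -> P z.
  by rewrite /P; case: ij => -[-> ->] [] ->; rewrite eqxx ?orbT.
have Ai z : z \in A -> c z = i -> z < f.
  by move=> zA eqc; apply: (H 0 1) => //; rewrite eqc.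
have Ay z : z \in A -> P z -> z < y.
  move=> zA /orP[]/eqP eqc; first by apply: (H 0 2) => //; rewrite ?inE ?eqc.
  by apply: ltn_trans xy; apply: (H 0 4) => //; rewrite ?inE ?eqc.
have yB z : z \in B -> c z = c y -> y < z by move=> zB eqc; apply: (H 2 5) => //; rewrite ?inE.
have xB z : z \in B -> P z -> x < z.
  move=> zB /orP[]/eqP eqc; first by apply: ltn_trans xy (yB _ zB eqc).
  by apply: (H 4 5) => //; rewrite ?inE.
pose c' z := match seg z with
  | 0 => c z | 1 => if P z then i else c z | 2 => j | 4 => i
  | _ => if c z == c y then j else if c z == c x then i else c z end.
have fx := ux fu.
exists c'.
  apply: colouring_new => [|a b z z'].
    split.
    - by apply: colouring_eq_in cA => z zA; rewrite /c' sA.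
    - move: u_inc; rewrite (sorted_pairwise ltn_trans).
      by apply: sub_pairwise_mem => z z' _ _ lt; apply/implyP.
    - move: v_inc; rewrite (sorted_pairwise ltn_trans).
      by apply: sub_pairwise_mem => z z' _ _ lt; apply/implyP.
    - case: ij => -[iE jE].
        by apply: (colouring_swap yk xk) cB => z zB; rewrite /c' sB // jE iE.
      apply: colouring_eq_in cB => z zB; rewrite /c' sB // iE jE.
      by case: eqP => // _; case: eqP.
  (* the pairs of segments, in the order of the new word *)
  case: a => [|[|[|[|[|[|a]]]]]]; case: b => [|[|[|[|[|[|b]]]]]] //= _;
      rewrite ?inE => za zb; rewrite /c';
      rewrite ?(sA z za) ?(su z za) ?(sv z za) ?(sB z za)
        ?(sA z' zb) ?(su z' zb) ?(sv z' zb) ?(sB z' zb)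
        ?(eqP za) ?(eqP zb) ?sx ?sy /=.
  - by move=> zk eqc; apply: Ay => //; apply: Pij; right.
  - case: ifP => [Pz' zk eqc|_]; last exact: (H 0 1).
    by apply: leq_trans (Ai z za eqc) (fmin _ zb Pz').
  - by move=> zk eqc; apply: ltn_trans (Ai z za eqc) fx.
  - case: eqP => [_ zk eqc|_].
      by apply: ltn_trans (Ay z za _) (yv zb); apply: Pij; right.
    case: eqP => [_ zk eqc|_]; last exact: (H 0 3).
    by apply: ltn_trans (Ai z za eqc) (ltn_trans fx (ltn_trans xy (yv zb))).
  - case: eqP => [eqC zk eqc|_].
      by apply: ltn_trans (Ay z za _) (yB _ zb eqC); apply: Pij; right.
    case: eqP => [eqD zk eqc|_]; last exact: (H 0 5).
    by apply: ltn_trans (Ai z za eqc) (ltn_trans fx (xB _ zb _)); rewrite /P eqD eqxx orbT.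
  - case: ifP => [_ _ eji|nP _ eqc]; first by rewrite eji eqxx in neij.
    by move: nP; rewrite Pij //; right.
  - by move=> _ eji; rewrite eji eqxx in neij.
  - by move=> _ _; apply: yv.
  - case: eqP => [eqC _ _|neqC]; first exact: yB.
    case: eqP => [_ _ eji|neqD _ eqc]; first by rewrite eji eqxx in neij.
    by case: ij eqc => -[_ ->] // /esym.
  - by move=> _ _; apply: ux.
  - by move=> _ _; apply: ltn_trans (uy _ za) (yv zb).
  - case: ifP => Pz; case: eqP => [eqC|neqC].
    + by move=> _ eij; rewrite eij eqxx in neij.
    + case: eqP => [eqD _ _|neqD _ eqc].
        by apply: ltn_trans (ux za) (xB _ zb _); rewrite /P eqD eqxx orbT.
      by case: ij eqc => -[-> _] // /esym.
    + by move=> _ eqc; move: Pz; rewrite Pij //; right.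
    + case: eqP => [_ _ eqc|_]; last exact: (H 1 5).
      by move: Pz; rewrite Pij //; left.
  - by move=> _ _; apply: ltn_trans xy (yv zb).
  - case: eqP => [_ _ eij|neqC]; first by rewrite eij eqxx in neij.
    case: eqP => [eqD _ _|neqD _ eqc].
      by apply: xB => //; rewrite /P eqD eqxx orbT.
    by case: ij eqc => -[-> _] // /esym.
  - move=> zk eqc; apply: (H 3 5) => //.
      by move: zk; do 2 (case: eqP => [->|_] //).
    clear - eqc xyc ij; move/eqP: xyc => xyc; move: eqc; case: ij => -[-> ->];
    by case: (c z =P c y); case: (c z' =P c y); case: (c z =P c x); case: (c z' =P c x); congruence.
rewrite count_new; apply: eq_in_count => z; rewrite /old /= cats0 !mem_cat.
rewrite !inE !mem_cat !inE /c'.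
case/orP => [zA|]; first by rewrite sA.
case/orP => [zu|].
  by rewrite su //; case: ifP => // /orP[]/eqP->; rewrite ik ?yk ?xk.
case/orP => [/eqP->|]; first by rewrite sy jk yk.
case/orP => [zv|].
  by rewrite sv //; case: eqP => [->|_]; [|case: eqP => [->|//]]; rewrite ?ik ?jk ?yk ?xk.
case/orP => [/eqP->|zB]; first by rewrite sx ik xk.
by rewrite sB //; case: eqP => [->|_]; [|case: eqP => [->|//]]; rewrite ?ik ?jk ?yk ?xk.
Qed.

(** For decreasing chains the pairs put out of order are those of [x] with
    letters of [v].  A chain using [w] in [v] and then [x] can trade [w] for
    [y] when [y] is free, as [x < y < w].  When [y] lies on another chain, the
    latter continues with [x] and what followed it, and the head ending with [w]
    continues with what followed [y]. *)
Lemma bump_transfers_dec : transfers gtn old new.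
Proof.
move=> k c /before_old[[cA cu cv cB] H].
have [seg segE] := segment_index.
have sA z : z \in A -> seg z = 0 by exact: (segE 0).
have su z : z \in u -> seg z = 1 by exact: (segE 1).
have sy : seg y = 2 by apply: (segE 2); rewrite inE.
have sv z : z \in v -> seg z = 3 by exact: (segE 3).
have sx : seg x = 4 by apply: (segE 4); rewrite inE.
have sB z : z \in B -> seg z = 5 by exact: (segE 5).
have count_new c' : count (fun z => c' z < k) new = count (fun z => c' z < k) old.
  by apply/esym/seq.permP/bump_perm.
have uy z : z \in u -> z < y by move=> /ux zx; apply: ltn_trans xy.
case: (boolP ((c x < k) && has (fun z => c z == c x) v)) => [|no_clash]; last first.
  exists c => //; apply: colouring_new => // i j z z'.
  (* the pairs of segments, in the order of the new word *)
  case: i => [|[|[|[|[|[|i]]]]]]; case: j => [|[|[|[|[|[|j]]]]]] //= _.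
  - by apply: (H 0 2).
  - by apply: (H 0 1).
  - by apply: (H 0 4).
  - by apply: (H 0 3).
  - by apply: (H 0 5).
  - by rewrite inE => /eqP-> /uy.
  - by apply: (H 2 4).
  - by apply: (H 2 3).
  - by apply: (H 2 5).
  - by apply: (H 1 4).
  - by apply: (H 1 3).
  - by apply: (H 1 5).
  - rewrite inE => /eqP-> z'v xk eqc; case/negP: no_clash; rewrite xk.
    by apply/hasP; exists z' => //; rewrite eqc.
  - by apply: (H 4 5).
  - by apply: (H 3 5).
case/andP=> xk /hasP[w wv /eqP eqw].
have yw := yv wv.
have v_once z : z \in v -> c z = c x -> z = w.
  move=> zv eqz; apply/eqP/negPn/negP => neq.
  move: v_inc cv; rewrite (sorted_pairwise ltn_trans) => v1 v2.
  have both : pairwise [rel a b | ltn a b && ((c a < k) && (c a == c b) ==> gtn a b)] v.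
    by rewrite pairwise_relI v1.
  have /orP[] := pairwise_mem2 both zv wv neq; rewrite /= eqz eqw xk eqxx /= => /andP[l1 l2];
    by move: (ltn_trans l1 l2); rewrite ltnn.
(* [y] is free: it takes the colour of [w] *)
case: (ltnP (c y) k) => yk; last first.
  exists (fun z => if seg z == 2 then c x else if z == w then c y else c z).
    apply: colouring_new => [|i j z z'].
      split.
      - apply: colouring_eq_in cA => z zs; rewrite (sA z zs) /=; case: eqP => // zw.
        by have := sA z zs; rewrite zw sv.
      - apply: colouring_eq_in cu => z zs; rewrite (su z zs) /=; case: eqP => // zw.
        by have := su z zs; rewrite zw sv.
      - apply: sub_pairwise_mem cv => z z' zs zs' /implyP imp; apply/implyP.
        rewrite !sv //=; case: (z =P w) => _ /andP[zk]; first by move: zk; rewrite ltnNge yk.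
        case: (z' =P w) => [_ /eqP zy|_ eqz]; first by move: zk; rewrite zy ltnNge yk.
        by apply: imp; rewrite zk.
      - apply: colouring_eq_in cB => z zs; rewrite (sB z zs) /=; case: eqP => // zw.
        by have := sB z zs; rewrite zw sv.
    have nw n z1 : seg z1 = n -> n != 3 -> (z1 == w) = false.
      by move=> s1 n3; apply/eqP => zw; move: n3; rewrite -s1 zw sv.
    have yk' : (c y < k) = false by rewrite ltnNge yk.
    case: i => [|[|[|[|[|[|i]]]]]]; case: j => [|[|[|[|[|[|j]]]]]] //= _;
      rewrite ?inE => zi zj;
      rewrite ?(sA z zi) ?(su z zi) ?(sv z zi) ?(sB z zi)
        ?(sA z' zj) ?(su z' zj) ?(sv z' zj) ?(sB z' zj)
        ?(eqP zi) ?(eqP zj) ?sx ?sy /=;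
      rewrite ?(nw _ _ (sA z zi)) ?(nw _ _ (su z zi)) ?(nw _ _ (sB z zi))
        ?(nw _ _ (su z' zj)) ?(nw _ _ (sB z' zj)) ?(nw _ _ sx) //.
    + move=> zk eqc; apply: ltn_trans yw _; apply: (H 0 3) => //; by rewrite eqw.
    + exact: (H 0 1).
    + by apply: (H 0 4); rewrite ?inE.
    + case: (z' =P w) => [_ zk eqc|_]; last exact: (H 0 3).
      by move: zk; rewrite eqc yk'.
    + exact: (H 0 5).
    + by move=> _ _; apply: uy.
    + case: (z' =P w) => [_ _ eqc|neq _ eqc]; first by rewrite eqc yk' in xk.
      by case: neq; apply: v_once.
    + by move=> _ eqc; apply: ltn_trans xy; apply: (H 4 5); rewrite ?inE.
    + by apply: (H 1 4); rewrite ?inE.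
    + case: (z' =P w) => [_ zk eqc|_]; last exact: (H 1 3).
      by move: zk; rewrite eqc yk'.
    + exact: (H 1 5).
    + case: (z' =P w) => [_ _ eqc|neq _ eqc]; first by rewrite eqc yk' in xk.
      by case: neq; apply: v_once.
    + by apply: (H 4 5); rewrite ?inE.
    + by case: (z =P w) => _; [rewrite yk'|apply: (H 3 5)].
  rewrite count_new.
  pose c' z := if seg z == 2 then c x else if z == w then c y else c z.
  change (count (fun z => c' z < k) old = count (fun z => c z < k) old).
  have cnt n (s : seq nat) : (forall z, z \in s -> seg z = n) -> n != 2 -> n != 3 ->
      count (fun z => c' z < k) s = count (fun z => c z < k) s.
    move=> sn /negPf n2 n3; apply: eq_in_count => z zs; rewrite /c' sn // n2.
    by case: (z =P w) => // zw; move: n3; rewrite -(sn z zs) zw sv.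
  have cntv : count (fun z => c' z < k) v + 1 = count (fun z => c z < k) v + 0.
    have uv : uniq v by move: v_inc; apply: sorted_uniq; [exact: ltn_trans|exact: ltnn].
    have := @count_change_one _ (fun z => c z < k) (fun z => c' z < k) v w uv wv.
    have cw : c' w = c y by rewrite /c' sv //= eqxx.
    rewrite cw eqw xk ltnNge yk; apply => z zv neq.
    by rewrite /c' sv // (negPf neq).
  rewrite /old /= cats0 !count_cat /= !count_cat /=.
  rewrite (cnt 0 A) // (cnt 1 u) // (cnt 5 B) //.
  have -> : c' y = c x by rewrite /c' sy.
  have -> : c' x = c x.
    by rewrite /c' sx /=; case: (x =P w) => // xw; move: sx; rewrite xw sv.
  by clear - cntv xk yk; rewrite xk ltnNge yk; move: cntv; lia.
have nyx : c y != c x.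
  apply/eqP => eqc; have := H 2 3 y w isT; rewrite /= inE eqxx => /(_ isT wv yk).
  by rewrite eqc eqw => /(_ erefl) /= wy; have := ltn_trans wy yw; rewrite ltnn.
pose c' z := match seg z with
  | 4 => c y | 5 => if c z == c x then c y else if c z == c y then c x else c z
  | _ => c z end.
exists c'.
  apply: colouring_new => [|a b z z'].
    split.
    - by apply: colouring_eq_in cA => z zA; rewrite /c' sA.
    - by apply: colouring_eq_in cu => z zu; rewrite /c' su.
    - by apply: colouring_eq_in cv => z zv; rewrite /c' sv.
    - by apply: (colouring_swap xk yk) cB => z zB; rewrite /c' sB.
  have nuy z1 : z1 \in u -> c z1 <> c y.
    move=> zu eqc; have := H 1 2 z1 y isT zu; rewrite /= inE eqxx eqc => /(_ isT yk erefl) /= lt.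
    by have := ltn_trans lt (uy _ zu); rewrite ltnn.
  have nux z1 : z1 \in u -> c z1 <> c x.
    move=> zu eqc; have := H 1 4 z1 x isT zu; rewrite /= inE eqxx eqc => /(_ isT xk erefl) /= lt.
    by have := ltn_trans lt (ux zu); rewrite ltnn.
  have nvy z1 : z1 \in v -> c y <> c z1.
    move=> zv eqc; have := H 2 3 y z1 isT; rewrite /= inE eqxx => /(_ isT zv yk eqc) /= lt.
    by have := ltn_trans lt (yv zv); rewrite ltnn.
  have Aw z1 : z1 \in A -> c z1 = c x -> w < z1.
    by move=> zA eqc; apply: (H 0 3); rewrite ?eqc ?eqw.
  have Ay z1 : z1 \in A -> c z1 = c y -> y < z1.
    by move=> zA eqc; apply: (H 0 2); rewrite ?inE ?eqc.
  have xB z1 : z1 \in B -> c z1 = c x -> z1 < x.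
    by move=> zB eqc; apply: (H 4 5); rewrite ?inE ?eqc.
  have yB z1 : z1 \in B -> c z1 = c y -> z1 < y.
    by move=> zB eqc; apply: (H 2 5); rewrite ?inE ?eqc.
  (* the pairs of segments, in the order of the new word *)
  case: a => [|[|[|[|[|[|a]]]]]]; case: b => [|[|[|[|[|[|b]]]]]] //= _;
      rewrite ?inE => za zb; rewrite /c';
      rewrite ?(sA z za) ?(su z za) ?(sv z za) ?(sB z za)
        ?(sA z' zb) ?(su z' zb) ?(sv z' zb) ?(sB z' zb)
        ?(eqP za) ?(eqP zb) ?sx ?sy /=.
  - by move=> _; apply: Ay.
  - exact: (H 0 1).
  - by move=> _ /(Ay z za); apply: ltn_trans.
  - exact: (H 0 3).
  - case: (c z' =P c x) => [/(xB z' zb) lt _ /(Ay z za)|_].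
      by apply: ltn_trans (ltn_trans lt xy).
    case: (c z' =P c y) => [/(yB z' zb) lt _ /(Aw z za)|_]; last exact: (H 0 5).
    by apply: ltn_trans (ltn_trans lt yw).
  - by move=> _ _; apply: uy.
  - by [].
  - by move=> _ /(nvy z' zb).
  - case: (c z' =P c x) => [/(xB z' zb) lt _ _|_]; first exact: ltn_trans xy.
    case: (c z' =P c y) => [_ _ eyx|ny _ eyc]; first by rewrite eyx eqxx in nyx.
    by case: ny.
  - by move=> _ /(nuy z za).
  - exact: (H 1 3).
  - case: (c z' =P c x) => [_ _ /(nuy z za)|_] //.
    by case: (c z' =P c y) => [_ _ /(nux z za)|_] //; apply: (H 1 5).
  - by move=> _ /(nvy z' zb).
  - case: (c z' =P c x) => [/(xB z' zb) lt _ _|_] //.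
    case: (c z' =P c y) => [_ _ eyx|ny _ eyc]; first by rewrite eyx eqxx in nyx.
    by case: ny.
  - case: (c z' =P c x) => [_ _ eqc|_]; first by case: (nvy z za); rewrite eqc.
    case: (c z' =P c y) => [/(yB z' zb) lt _ /(v_once z za)->|_]; last exact: (H 3 5).
    exact: ltn_trans yw.
rewrite count_new; apply: eq_in_count => z; rewrite /old /= cats0 !mem_cat.
rewrite !inE !mem_cat !inE /c'.
case/orP => [zA|]; first by rewrite sA.
case/orP => [zu|]; first by rewrite su.
case/orP => [/eqP->|]; first by rewrite sy.
case/orP => [zv|]; first by rewrite sv.
case/orP => [/eqP->|zB]; first by rewrite sx xk yk.
by rewrite sB //; case: eqP => [->|_]; [|case: eqP => [->|//]]; rewrite ?yk ?xk.
Qed.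
End Bump.

(** * The two inequalities of Greene's theorem *)

Definition reading (t : seq (seq nat)) : seq nat := flatten (rev t).

(** The column condition on two consecutive rows of a standard tableau. *)
Definition dominates : rel (seq nat) := fun r r' =>
  (size r' <= size r) && all (fun j => nth 0 r j < nth 0 r' j) (iota 0 (size r')).

Definition tableau (t : seq (seq nat)) := all (sorted ltn) t && sorted dominates t.

Lemma transfers_refl e s : transfers e s s.
Proof. by move=> k c cs; exists c. Qed.

Lemma transfers_trans e s2 s1 s3 :
  transfers e s1 s2 -> transfers e s2 s3 -> transfers e s1 s3.
Proof.
move=> t12 t23 k c /t12[c2 /t23[c3 cs3 n3] n2].
by exists c3 => //; rewrite n3.
Qed.

Lemma reading_cons r t : reading (r :: t) = reading t ++ r.
Proof. by rewrite /reading rev_cons flatten_rcons. Qed.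

Lemma nth_sorted_lt r i j : sorted ltn r -> i < j -> j < size r -> nth 0 r i < nth 0 r j.
Proof.
move=> sr ij jr; have := sorted_ltn_nth ltn_trans 0 sr i j.
by apply=> //; rewrite inE //; apply: ltn_trans jr.
Qed.

Lemma bump_row r x (i := find (fun y => x < y) r) : sorted ltn r -> x \notin r -> i < size r ->
  exists u v, [/\ r = u ++ nth 0 r i :: v, set_nth 0 r i x = u ++ x :: v,
    sorted ltn u, sorted ltn v & [/\ forall z, z \in u -> z < x, x < nth 0 r i &
    forall z, z \in v -> nth 0 r i < z]].
Proof.
move=> sr xr ir; exists (take i r), (drop i.+1 r).
have xy : x < nth 0 r i by apply: (@nth_find _ _ (fun y => x < y)); rewrite has_find.
have rE : r = take i r ++ nth 0 r i :: drop i.+1 r by rewrite -drop_nth // cat_take_drop.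
split => //.
- by rewrite set_nthE ir.
- exact: take_sorted.
- exact: drop_sorted.
split => // z.
  case/(nthP 0) => j; rewrite size_takel ?(ltnW ir) // => ji; rewrite nth_take // => <-.
  rewrite ltn_neqAle leqNgt (before_find 0 ji) andbT.
  by apply: contraNneq xr => <-; apply: mem_nth; apply: ltn_trans ir.
case/(nthP 0) => j; rewrite size_drop => jr; rewrite nth_drop => <-.
by apply: nth_sorted_lt => //; [rewrite addSn ltnS leq_addr|rewrite -ltn_subRL].
Qed.

Lemma sorted_rcons_max r x : sorted ltn r -> x \notin r ->
  size r <= find (fun y => x < y) r -> sorted ltn (rcons r x).
Proof.
move=> sr xr le; rewrite (sorted_pairwise ltn_trans) pairwise_rcons.
rewrite -(sorted_pairwise ltn_trans) sr andbT.
have : ~~ has (fun y => x < y) r by rewrite has_find -leqNgt.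
rewrite -all_predC => /allP all_le; apply/allP => z zr; move: (all_le z zr) => /=.
by rewrite -leqNgt leq_eqVlt => /predU1P[zx|//]; rewrite -zx zr in xr.
Qed.

Lemma insert_transfers t x B : all (sorted ltn) t -> uniq (reading t ++ x :: B) ->
  [/\ perm_eq (reading t ++ x :: B) (reading (schensted_insert t x) ++ B),
      all (sorted ltn) (schensted_insert t x),
      transfers ltn (reading t ++ x :: B) (reading (schensted_insert t x) ++ B) &
      transfers gtn (reading t ++ x :: B) (reading (schensted_insert t x) ++ B)].
Proof.
elim: t x B => [|r t IH] x B /=; first by split => //; apply: transfers_refl.
move=> /andP[sr st]; rewrite !reading_cons -catA => U.
have xr : x \notin r.
  move: U; rewrite !cat_uniq => /and3P[_ _ /and3P[_ /hasPn H _]].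
  by have := H x; rewrite inE eqxx; apply.
case: ifPn => [ir|]; last first.
  rewrite -leqNgt => ir /=; rewrite reading_cons -catA cat_rcons.
  by split; rewrite ?sorted_rcons_max ?st //; apply: transfers_refl.
have [u [v [rE -> su sv [ux xy yv]]]] := bump_row sr xr ir.
move: rE xy yv U; set y := nth 0 r _ => -> xy yv U.
have oldE : reading t ++ (u ++ y :: v) ++ x :: B
  = flatten [:: reading t; u; [:: y]; v; [:: x]; B] by rewrite /= cats0 -catA.
have newE : flatten [:: reading t; [:: y]; u; [:: x]; v; B]
  = reading t ++ y :: (u ++ x :: v) ++ B by rewrite /= cats0 -!catA.
rewrite oldE in U.
have P1 := bump_perm (reading t) u v B x y.
have T1 := bump_transfers_inc su sv ux xy yv U.
have T2 := bump_transfers_dec su sv ux xy yv U.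
have U' : uniq (reading t ++ y :: (u ++ x :: v) ++ B) by rewrite -newE -(perm_uniq P1).
have [P2 S2 T3 T4] := IH y _ st U'.
rewrite reading_cons oldE -[(reading (schensted_insert t y) ++ _) ++ B]catA; split.
- by apply: perm_trans P1 _; rewrite newE.
- rewrite /= S2 andbT (sorted_pairwise ltn_trans) pairwise_cat pairwise_cons.
  rewrite -!(sorted_pairwise ltn_trans) su sv !andbT.
  apply/and3P; split => //; last by apply/allP => z /yv; apply: ltn_trans.
  apply/allrelP => a b /ux ax; rewrite inE => /predU1P[->//|/yv yb].
  exact: ltn_trans ax (ltn_trans xy yb).
- by apply: transfers_trans T1 _; rewrite newE.
- by apply: transfers_trans T2 _; rewrite newE.
Qed.

Lemma dominatesP r r' : reflect (size r' <= size r /\ forall j, j < size r' -> nth 0 r j < nth 0 r' j)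
  (dominates r r').
Proof.
apply: (iffP andP) => -[le H]; split => //.
  by move=> j jr; apply: (allP H); rewrite mem_iota.
by apply/allP => j; rewrite mem_iota => /andP[_]; apply: H.
Qed.

Lemma dominates_trans : transitive dominates.
Proof.
move=> r2 r1 r3 /dominatesP[le12 H12] /dominatesP[le23 H23]; apply/dominatesP; split.
  exact: leq_trans le12.
by move=> j jr; apply: ltn_trans (H12 j _) (H23 j jr); apply: leq_trans le23.
Qed.

(** The entry bumped from a row lands in the next one weakly to the left of the
    place it left, below an entry smaller than itself. *)
Lemma insert_dominates t x : all (sorted ltn) t -> sorted dominates t ->
  sorted dominates (schensted_insert t x).
Proof.
elim: t x => [|r t IH] x //= /andP[sr st] dt.
case: ifPn => [ir|_] /=; last first.
  case: t {IH st} dt => //= r2 t /andP[/dominatesP[le H] ->]; rewrite andbT.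
  apply/dominatesP; rewrite size_rcons; split; first exact: leqW.
  by move=> j jr; rewrite nth_rcons (leq_trans jr le); apply: H.
have {}IH := IH (nth 0 r (find (fun y => x < y) r)) st (path_sorted dt).
move: ir IH; set i := find _ r; set y := nth 0 r i => ir IH.
have xy : x < y by apply: (@nth_find _ _ (fun y => x < y)); rewrite has_find.
have szr' : size (set_nth 0 r i x) = size r by rewrite size_set_nth; apply/maxn_idPr.
have r'le j : j <= i -> nth 0 (set_nth 0 r i x) j < y.
  rewrite nth_set_nth /=; case: eqP => [//|/eqP ji] le_ji.
  by apply: nth_sorted_lt => //; rewrite ltn_neqAle ji.
have r'r j : nth 0 (set_nth 0 r i x) j <= nth 0 r j.
  by rewrite nth_set_nth /=; case: eqP => // ->; apply: ltnW.
case: t dt st IH => [|r2 t] /= dt st IH.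
  rewrite andbT; apply/dominatesP; rewrite szr'; split; first exact: leq_ltn_trans ir.
  by case=> // _; apply: r'le.
case/andP: dt => /dominatesP[le H] dt.
have find_le : i < size r2 -> find (fun z => y < z) r2 <= i.
  move=> ir2; rewrite leqNgt; apply/negP => lt; have := before_find 0 lt => /=.
  by rewrite H.
move: IH => /=; case: ifPn => [i2r|].
  set i2 := find _ r2 in i2r find_le *; move=> /= ->; rewrite andbT.
  have i2i : i2 <= i.
    by case: (ltnP i (size r2)) => [/find_le //|/(leq_trans i2r)/ltnW].
  apply/dominatesP; rewrite szr' size_set_nth (maxn_idPr i2r); split=> // j jr.
  rewrite [X in _ < X]nth_set_nth /=; case: eqP => [->|_]; first exact: r'le.
  by apply: leq_ltn_trans (r'r j) (H j jr).
rewrite -leqNgt => i2r /= ->; rewrite andbT.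
have r2i : size r2 <= i.
  by rewrite leqNgt; apply/negP => lt; have := leq_ltn_trans (leq_trans i2r (find_le lt)) lt; rewrite ltnn.
apply/dominatesP; rewrite szr' size_rcons; split; first exact: leq_ltn_trans ir.
move=> j; rewrite ltnS [X in _ < X]nth_rcons => jr; case: (ltnP j (size r2)) => [jr2|r2j].
  by apply: leq_ltn_trans (r'r j) (H j jr2).
by rewrite (_ : j == size r2) ?eqn_leq ?jr //; apply: r'le; apply: leq_trans r2i.
Qed.

Lemma foldl_insert t s : tableau t -> uniq (reading t ++ s) ->
  [/\ tableau (foldl schensted_insert t s),
      perm_eq (reading t ++ s) (reading (foldl schensted_insert t s)),
      transfers ltn (reading t ++ s) (reading (foldl schensted_insert t s)) &
      transfers gtn (reading t ++ s) (reading (foldl schensted_insert t s))].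
Proof.
elim: s t => [|x s IH] t; first by rewrite cats0 /=; split => //; apply: transfers_refl.
move=> /andP[st dt] U /=; have [P1 S1 T1 T2] := insert_transfers st U.
have tab : tableau (schensted_insert t x) by rewrite /tableau S1 insert_dominates.
have [| tab' P2 T3 T4] := IH _ tab; first by rewrite -(perm_uniq P1).
split=> //; first exact: perm_trans P2.
  exact: transfers_trans T3.
exact: transfers_trans T4.
Qed.

Lemma schensted_spec s : uniq s ->
  [/\ tableau (schensted s), perm_eq s (reading (schensted s)),
      transfers ltn s (reading (schensted s)) & transfers gtn s (reading (schensted s))].
Proof. by move=> us; apply: (@foldl_insert [::]). Qed.

Lemma distinct_colours k c (s : seq nat) :
  pairwise (fun z z' => (c z < k) && (c z == c z') ==> false) s ->
  count (fun z => c z < k) s <= minn k (size s).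
Proof.
move=> H; rewrite leq_min count_size andbT -size_filter -(size_map c).
rewrite -[X in _ <= X](size_iota 0); apply: uniq_leq_size; last first.
  by move=> a /mapP[z]; rewrite mem_filter => /andP[zk _] ->; rewrite mem_iota.
rewrite uniq_pairwise pairwise_map.
have := pairwise_filter (fun z => c z < k) H.
apply: sub_pairwise_mem => z z'; rewrite mem_filter => /andP[zk _] _.
by rewrite zk /=; case: (c z == c z').
Qed.

(** An [e]-chain and an [e']-chain share at most one letter when [e] and [e']
    exclude each other. *)
Lemma clash_colours (e e' : rel nat) k c s : (forall z z', e z z' -> e' z z' -> false) ->
  colouring e k c s -> pairwise e' s -> count (fun z => c z < k) s <= minn k (size s).
Proof.
move=> clash cs es; apply: distinct_colours.
have : pairwise [rel z z' | ((c z < k) && (c z == c z') ==> e z z') && e' z z'] s.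
  by rewrite pairwise_relI es andbT.
apply: sub_pairwise => z z' /= /andP[/implyP H e'zz]; apply/implyP => /H ezz.
exact: clash ezz e'zz.
Qed.

Definition column (t : seq (seq nat)) j := [seq nth 0 r j | r <- t & j < size r].

Lemma column_subseq t j : subseq (column t j) (flatten t).
Proof.
elim: t => //= r t IH; rewrite /column /=; case: ifP => [jr|_]; last exact: subseq_trans (suffix_subseq _ _).
by rewrite /= -cat1s; apply: cat_subseq => //; rewrite sub1seq mem_nth.
Qed.

Lemma count_flatten_columns (p : pred nat) t M : all (fun r => size r <= M) t ->
  count p (flatten t) = \sum_(j < M) count p (column t j).
Proof.
elim: t => [|r t IH] /=; first by rewrite big1.
move=> /andP[rM tM]; rewrite count_cat IH //.
have -> : count p r = \sum_(j < M) ((j < size r) && p (nth 0 r j)).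
  rewrite -sum1_count (big_nth 0) big_mkord (big_ord_widen_cond M (fun i => p (nth 0 r i)) (fun _ => 1)) //.
  by rewrite big_mkcond /=; apply: eq_bigr => j _; rewrite andbC; case: andb.
rewrite -big_split /=; apply: eq_bigr => j _; rewrite /column /=.
by case: (j < size r).
Qed.

Lemma geq_trans : transitive geq.
Proof. by move=> b a c /= ba cb; apply: leq_trans cb ba. Qed.

(** Both sides count the cells in the first [k] rows of the diagram of [l]. *)
Lemma sum_min_columns (l : seq nat) k M : sorted geq l -> all (fun a => a <= M) l ->
  \sum_(j < M) minn k (count (fun r => j < r) l) = \sum_(i < k) nth 0 l i.
Proof.
elim: l k => [|a l IH] k sl aM.
  rewrite big1; last by move=> j _; rewrite minn0.
  by rewrite big1 // => i _; rewrite nth_nil.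
case: k => [|k].
  by rewrite big_ord0 big1 // => j _; rewrite min0n.
move: aM => /= /andP[aM lM].
have aE : a = \sum_(j < M) (j < a).
  rewrite -[LHS](card_ord a) -sum1_card (big_ord_widen_cond M xpredT (fun _ => 1)) //.
  by rewrite big_mkcond /=; apply: eq_bigr => j _; case: (j < a).
rewrite big_ord_recl /= -(IH k (path_sorted sl) lM) [X in _ = X + _]aE.
rewrite -big_split /=; apply: eq_bigr => j _.
case: (ltnP j a) => ja; first by rewrite !add1n minnSS.
rewrite (@eq_in_count _ _ pred0) ?count_pred0 ?minn0 // => b bl /=.
move: sl; rewrite /= (path_sortedE geq_trans) => /andP[/allP/(_ b bl) ba _].
by apply/negbTE; rewrite -leqNgt; apply: leq_trans ja.
Qed.

Section Greene.
Variable s : seq nat.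
Hypothesis us : uniq s.
Let l := shape (schensted s).

Lemma sorted_shape : sorted geq l.
Proof.
have [/andP[_ dt] _ _ _] := schensted_spec us; rewrite /l /shape sorted_map.
by apply: sub_sorted dt => r r' /dominatesP[].
Qed.

Lemma sumn_shape : sumn l = size s.
Proof.
have [_ /perm_size -> _ _] := schensted_spec us.
by rewrite /l /reading size_flatten /shape map_rev sumn_rev.
Qed.

(** In the reading word of a tableau each column is a decreasing chain, so [k]
    increasing chains cover at most [k] of its cells. *)
Lemma greene_inc k c : colouring ltn k c s ->
  count (fun z => c z < k) s <= \sum_(i < k) nth 0 l i.
Proof.
move=> cs; have [/andP[_ dt] _ T _] := schensted_spec us; have [c' c't <-] := T k c cs.
have lM : all (fun a => a <= sumn l) l.
  apply/allP => a; elim: (l) => //= b l' IH; rewrite inE => /predU1P[->|/IH]; first exact: leq_addr.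
  by move/leq_trans; apply; apply: leq_addl.
rewrite (@count_flatten_columns _ _ (sumn l)); last first.
  by rewrite all_rev; move: lM; rewrite {1}/l all_map.
rewrite -(sum_min_columns _ sorted_shape lM); apply: leq_sum => j _.
have -> : count (fun r => j < r) l = size (column (rev (schensted s)) j).
  by rewrite size_map size_filter count_rev /l count_map.
apply: (clash_colours (e := ltn) (e' := gtn)) => [z z' /= lt1 lt2||].
- by have := ltn_trans lt1 lt2; rewrite ltnn.
- exact: subseq_pairwise (column_subseq _ _) c't.
rewrite /column pairwise_map -sorted_pairwise; last by move=> b a c0 /= ab bc; apply: ltn_trans bc ab.
rewrite filter_rev rev_sorted (sorted_pairwise dominates_trans) in dt *.
apply: pairwise_sorted; have := pairwise_filter (fun r => j < size r) dt.
apply: sub_pairwise_mem => r r' _; rewrite mem_filter => /andP[jr' _] /dominatesP[_].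
by apply.
Qed.

Lemma greene_dec k c : colouring gtn k c s ->
  count (fun z => c z < k) s <= \sum_(r <- l) minn k r.
Proof.
move=> cs; have [/andP[st _] _ _ T] := schensted_spec us; have [c' c't <-] := T k c cs.
rewrite count_flatten sumnE big_map (perm_big (schensted s)) ?perm_rev //= /l /shape big_map.
rewrite big_seq [X in _ <= X]big_seq; apply: leq_sum => r rt.
apply: (clash_colours (e := gtn) (e' := ltn)) => [z z' /= lt1 lt2||].
- by have := ltn_trans lt1 lt2; rewrite ltnn.
- move: c't; rewrite /colouring /reading pairwise_flatten => /andP[/allP H _].
  by apply: H; rewrite mem_rev.
by rewrite -(sorted_pairwise ltn_trans); apply: (allP st).
Qed.
End Greene.

(** The first [k] rows and the first [t] columns of the diagram have at most
    [k * t] cells in common. *)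
Lemma greene_duality (l : seq nat) k t :
  \sum_(i < k) nth 0 l i + \sum_(r <- l) minn t r <= sumn l + k * t.
Proof.
elim: l k => [|a l IH] k.
  by rewrite big_nil big1 // => i _; rewrite nth_nil.
rewrite big_cons /=; case: k => [|k].
  have := IH 0; rewrite !big_ord0 !mul0n !add0n !addn0 => le.
  by rewrite leq_add ?geq_minr.
rewrite big_ord_recl /= mulSn.
change (a + \sum_(i < k) nth 0 l i + (minn t a + \sum_(r <- l) minn t r)
  <= a + sumn l + (t + k * t)).
by rewrite addnACA [X in _ <= X]addnACA leq_add // leq_add2l geq_minl.
Qed.

Import Order.TTheory GRing.Theory Num.Theory.
(** * Partial sums of a partition and the fibres of a labelling *)

(** Here [P k] stands for the number of cells in the first [k] rows of the
    shape and [P' t] for that in its first [t] columns, or conversely; the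
    fibres of [X] are chains of the direction bounded by [P']. *)
Section Fibres.
Variables (I T : eqType) (X : I -> T) (s : seq I).

Lemma count_fibres (p : pred I) (cols : seq T) : uniq cols ->
  {in s, forall i, p i -> X i \in cols} ->
  count p s = \sum_(x <- cols) count (fun i => (X i == x) && p i) s.
Proof.
move=> uc; elim: s => [|i s' IH] H /=; first by rewrite big1.
rewrite IH => [|j js]; last by apply: H; rewrite inE js orbT.
rewrite big_split /=; congr (_ + _)%N.
have := H i (mem_head _ _); case: (p i) => [/(_ isT) Xi|_]; last first.
  by rewrite big1 // => x _; rewrite andbF.
rewrite (bigD1_seq (X i)) //= eqxx big1 //.
by move=> x; rewrite eq_sym => /negPf ->.
Qed.

Variables (P P' : nat -> nat).
Let cols := undup (map X s).
Let height x := count (fun i => X i == x) s.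

Hypothesis dual : forall k t, (P k + P' t <= size s + k * t)%N.
Hypothesis bound : forall t (c : I -> nat),
  {in s &, forall i j, (c i < t)%N -> c i = c j -> X i = X j} ->
  (count (fun i => c i < t)%N s <= P' t)%N.

Let heightsE (p : pred T) : (\sum_(x <- cols | p x) height x)%N = count (fun i => p (X i)) s.
Proof.
rewrite (@count_fibres _ [seq x <- cols | p x]) ?filter_uniq ?undup_uniq //.
  rewrite big_filter; apply: eq_bigr => x px; apply: eq_count => i.
  by case: eqP => // ->; rewrite px.
by move=> i si /= pX; rewrite mem_filter pX mem_undup map_f.
Qed.

(** The fibres with at least [k] points are themselves a family of chains,
    which bounds [P'] from below, and [P] from above by duality. *)
Lemma fibre_sum_ub k : (P k <= \sum_(x <- cols) minn k (height x))%N.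
Proof.
pose tall := [seq x <- cols | (k <= height x)%N]; pose t := size tall.
have tallP i : i \in s -> (index (X i) tall < t)%N = (k <= height (X i))%N.
  by move=> si; rewrite index_mem mem_filter mem_undup map_f // andbT.
have := bound (t := t) (c := fun i => index (X i) tall).
rewrite (eq_in_count tallP) => tall_bound.
have le : (\sum_(x <- cols | (k <= height x)%N) height x <= P' t)%N.
  rewrite (heightsE (fun x => k <= height x)%N); apply: tall_bound => i j si sj.
  rewrite index_mem => ti eqi; apply/eqP; rewrite -(nth_index (X i) ti) eqi.
  by rewrite nth_index // -index_mem -eqi index_mem.
have sizeE : size s = (\sum_(x <- cols) height x)%N.
  by rewrite (heightsE predT) count_predT.
move: (dual k t); rewrite sizeE (bigID (fun x => k <= height x)%N) /=.
rewrite [X in (_ -> _ <= X)%N](bigID (fun x => k <= height x)%N) /=.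
have -> : (\sum_(x <- cols | (k <= height x)%N) minn k (height x) = k * t)%N.
  rewrite (eq_bigr (fun=> k)) => [|x kx]; last exact/minn_idPl.
  by rewrite -big_filter big_const_seq count_predT iter_addn_0.
have -> : (\sum_(x <- cols | ~~ (k <= height x)%N) minn k (height x)
   = \sum_(x <- cols | ~~ (k <= height x)%N) height x)%N.
  by apply: eq_bigr => x; rewrite -ltnNge => /ltnW/minn_idPr.
move: le; set a := bigop _ _ _; set b := bigop _ _ _; lia.
Qed.

(** Chains are not mentioned: the bound by [P k] is all that is known of a family
    of [k] chains here. *)
Definition attained k := exists2 c : I -> nat, (count (fun i => c i < k)%N s <= P k)%N &
   {in s, forall i, (minn k (height (X i)) <= count (fun j => (X j == X i) && (c j < k)) s)%N}.

Lemma fibre_sum k : attained k -> P k = (\sum_(x <- cols) minn k (height x))%N.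
Proof.
case=> c cP cX; apply/eqP; rewrite eqn_leq fibre_sum_ub /=.
apply: leq_trans cP; rewrite (@count_fibres _ cols) ?undup_uniq //; last first.
  by move=> i si _; rewrite mem_undup map_f.
rewrite big_seq [X in (_ <= X)%N]big_seq; apply: leq_sum => x.
by rewrite mem_undup => /mapP[i si ->]; apply: cX.
Qed.

Lemma fibre_diff k : attained k -> attained k.+1 ->
  (P k + count (fun x => k < height x)%N cols = P k.+1)%N.
Proof.
move=> ak ak1; rewrite !fibre_sum // -sum1_count [X in (_ + X)%N]big_mkcond -big_split /=.
by apply: eq_bigr => x _; case: (ltnP k (height x)); lia.
Qed.
End Fibres.

Local Open Scope ring_scope.

(** * Integer points between two broken lines *)

Lemma size_ints_lt (R : realType) (a b : R) (s : seq int) : a <= b -> uniq s ->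
  {in s, forall z : int, a <= z%:~R < b} -> (size s)%:R < b - a + 1.
Proof.
move=> ab us sab.
pose N := `|Num.ceil b - Num.ceil a|%N.
have NE : (N%:Z = Num.ceil b - Num.ceil a)%R by rewrite gez0_abs // subr_ge0 le_ceil.
have : (size s <= N)%N.
  rewrite -(size_iota 0 N) -(size_map (fun j : nat => Num.ceil a + j%:Z)).
  apply: uniq_leq_size => // z /sab /andP[az zb]; apply/mapP.
  move: az zb; rewrite -ceil_le_int -ceil_gt_int => az zb.
  have zaE : (`|z - Num.ceil a|%N%:Z = z - Num.ceil a)%R by rewrite gez0_abs // subr_ge0.
  exists `|z - Num.ceil a|%N; last by rewrite zaE addrC subrK.
  by rewrite mem_iota /= add0n -ltz_nat zaE NE ltrD2r.
rewrite -(ler_nat R) => le; apply: le_lt_trans le _.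
rewrite -[N%:R]/((N%:Z)%:~R) NE intrB.
by have := ceilB1_lt b; have := ceil_ge a; rewrite intrB; lra.
Qed.

Lemma size_ints_gt (R : realType) (a b : R) (s : seq int) :
  (forall z : int, a <= z%:~R < b -> z \in s) -> b - a - 1 < (size s)%:R.
Proof.
move=> sab; case: (lerP b a) => ab; first by have : 0 <= (size s)%:R :> R by []; lra.
pose N := `|Num.ceil b - Num.ceil a|%N.
have NE : (N%:Z = Num.ceil b - Num.ceil a)%R by rewrite gez0_abs // subr_ge0 le_ceil // ltW.
have : (N <= size s)%N.
  rewrite -[X in (X <= _)%N](size_iota 0 N) -(size_map (fun j : nat => Num.ceil a + j%:Z)).
  apply: uniq_leq_size.
    by rewrite map_inj_uniq ?iota_uniq // => i j; lia.
  move=> z /mapP[j]; rewrite mem_iota => /andP[_ jN] ->; apply: sab.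
  by rewrite -ceil_le_int -ceil_gt_int lerDl lez_nat /= -ltrBrDl -NE ltz_nat.
rewrite -(ler_nat R) => le; apply: lt_le_trans le.
rewrite -[N%:R]/((N%:Z)%:~R) NE intrB.
by have := ceilB1_lt a; have := ceil_ge b; rewrite intrB; lra.
Qed.

(** The ends of the columns of a rectangle in lattice coordinates, with the
    origin at the left vertex of the inscribed parallelogram, whose sides are
    [x0] and [y0]: each of the four lines is one side of the rectangle. *)
Definition strip_lower (R : realType) (rho sigma x0 d : R) := Num.max (- sigma * d) (rho * (d - x0)).
Definition strip_upper (R : realType) (rho sigma x0 y0 d : R) := y0 + Num.min (rho * d) (sigma * (x0 - d)).

(** The bounds [strip_lower] and [strip_upper - k] cross at the two points of
    abscissas [- w] and [x0 + w], with [w = (y0 - k) / (rho + sigma)].  The line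
    through these two points works: between them by convexity, and outside
    because its slope lies between [- sigma] and [rho]. *)
Lemma strip_line (R : realType) (rho sigma x0 y0 : R) (sigma0 : 0 < sigma) (sigma1 : sigma < 1)
    (rho1 : 1 < rho) (x00 : 0 <= x0) (k : R) : k < y0 -> exists th g0 : R,
  [/\ 0 <= th, th <= (rho - sigma) / 2 &
  forall d, let g := g0 + th * d in
    if - ((y0 - k) / (rho + sigma)) <= d <= x0 + (y0 - k) / (rho + sigma)
    then strip_lower rho sigma x0 d <= g <= strip_upper rho sigma x0 y0 d - k
    else strip_upper rho sigma x0 y0 d - k <= g <= strip_lower rho sigma x0 d].
Proof.
move=> ky; set w := (y0 - k) / (rho + sigma).
have rs0 : 0 < rho + sigma by lra.
have w0 : 0 < w by rewrite divr_gt0 // subr_gt0.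
have kE : y0 = k + (rho + sigma) * w by rewrite /w mulrC divfK ?gt_eqF //; lra.
have L0 : 0 < x0 + 2 * w by lra.
pose th := (rho - sigma) * w / (x0 + 2 * w).
have thE : th * (x0 + 2 * w) = (rho - sigma) * w by rewrite divfK ?gt_eqF.
have rms : 0 <= rho - sigma by lra.
have th0 : 0 <= th by apply: divr_ge0; [apply: mulr_ge0 => //; exact: ltW|exact: ltW].
have th1 : th <= (rho - sigma) / 2.
  rewrite ler_pdivrMr // -subr_ge0.
  have -> : (rho - sigma) / 2 * (x0 + 2 * w) - (rho - sigma) * w = (rho - sigma) / 2 * x0 by field.
  by rewrite mulr_ge0 // divr_ge0 //; lra.
exists th, (sigma * w + th * w); split => // d /=.
rewrite /strip_lower /strip_upper.
have e1 : sigma * w + th * w + th * d = sigma * w + th * (d + w) by ring.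
have e2 : sigma * w + th * w + th * d = rho * w + th * (d - x0 - w).
  have -> : rho * w = sigma * w + (rho - sigma) * w by ring.
  by rewrite -thE; ring.
rewrite kE.
case: ifPn => [/andP[d1 d2]|].
  have m1 : 0 <= th * (d + w) by rewrite mulr_ge0 //; lra.
  have m2 : 0 <= (rho - th) * (x0 + w - d) by rewrite mulr_ge0 //; lra.
  have m3 : 0 <= (rho - th) * (d + w) by rewrite mulr_ge0 //; lra.
  have m4 : 0 <= th * (x0 + w - d) by rewrite mulr_ge0 //; lra.
  have m5 : 0 <= sigma * (d + w) by rewrite mulr_ge0 //; lra.
  have m6 : 0 <= sigma * (x0 + w - d) by rewrite mulr_ge0 //; lra.
  rewrite ge_max; apply/andP; split; first by apply/andP; split; nra.
  rewrite lerBrDr -lerBlDl le_min; apply/andP; split; nra.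
rewrite negb_and -!ltNge => /orP[d1|d1].
  have m1 : 0 <= (sigma + th) * (- w - d) by rewrite mulr_ge0 //; lra.
  have m3 : 0 <= (rho - th) * (- w - d) by rewrite mulr_ge0 //; lra.
  apply/andP; split; last by rewrite le_max; apply/orP; left; nra.
  by rewrite lerBlDr -lerBrDl ge_min; apply/orP; left; nra.
have m1 : 0 <= (sigma + th) * (d - (x0 + w)) by rewrite mulr_ge0 //; lra.
have m3 : 0 <= (rho - th) * (d - (x0 + w)) by rewrite mulr_ge0 //; lra.
apply/andP; split; last by rewrite le_max; apply/orP; right; nra.
by rewrite lerBlDr -lerBrDl ge_min; apply/orP; right; nra.
Qed.

Lemma strip_height_gt (R : realType) (rho sigma x0 y0 k d : R)
    (sigma0 : 0 < sigma) (rho1 : 1 < rho) :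
  k < strip_upper rho sigma x0 y0 d - strip_lower rho sigma x0 d ->
  - ((y0 - k) / (rho + sigma)) < d < x0 + (y0 - k) / (rho + sigma).
Proof.
set w := (y0 - k) / (rho + sigma).
have rs0 : 0 < rho + sigma by lra.
have kE : y0 = k + (rho + sigma) * w by rewrite /w mulrC divfK ?gt_eqF //; lra.
have u1 : strip_upper rho sigma x0 y0 d <= y0 + rho * d by rewrite lerD2l ge_min lexx.
have u2 : strip_upper rho sigma x0 y0 d <= y0 + sigma * (x0 - d) by rewrite lerD2l ge_min lexx orbT.
have l1 : - sigma * d <= strip_lower rho sigma x0 d by rewrite le_max lexx.
have l2 : rho * (d - x0) <= strip_lower rho sigma x0 d by rewrite le_max lexx orbT.
move=> H.
have a1 : 0 < (rho + sigma) * (d + w) by nra.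
have a2 : 0 < (rho + sigma) * (x0 + w - d) by nra.
by move: a1 a2; rewrite !pmulr_rgt0 // => a1 a2; apply/andP; split; lra.
Qed.

(** Rounding may add up to one unit to an increment, and the slope of
    [strip_line] leaves room for it: if [th <= 1] the rounded increment over [m]
    steps is at most [m], and otherwise [th + 1 < rho]. *)
Lemma ceil_slope (R : realType) (rho sigma th g : R) (m : int)
    (sigma0 : 0 < sigma) (rho1 : 1 < rho) :
  0 <= th -> th <= (rho - sigma) / 2 -> 0 < m ->
  0 <= Num.ceil (g + th * m%:~R) - Num.ceil g /\
  (Num.ceil (g + th * m%:~R) - Num.ceil g)%:~R < rho * m%:~R.
Proof.
move=> th0 th1 m0.
have m1 : 1 <= m%:~R :> R by rewrite ler1z; lia.
have tm : 0 <= th * m%:~R by rewrite mulr_ge0 //; lra.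
split; first by rewrite subr_ge0 le_ceil // lerDl.
case: (lerP th 1) => th_1.
  apply: le_lt_trans (_ : m%:~R < _); last by rewrite ltr_pMl ; lra.
  rewrite ler_int lerBlDr ceil_le_int intrD.
  have : th * m%:~R <= m%:~R by rewrite ler_piMl //; lra.
  by have := ceil_ge g; lra.
rewrite intrB; have := ceilB1_lt (g + th * m%:~R); have := ceil_ge g; rewrite intrB => c1 c2.
have : th * m%:~R + 1 <= rho * m%:~R.
  have : 0 <= (rho - th - 1) * m%:~R by rewrite mulr_ge0; lra.
  lra.
lra.
Qed.

(** * Lattice points in a rectangle *)

(** Lattice points [x (p, A) + y (q, - B)] of the box with corner [(c, d)], width
    [N] and height [T]; [u] and [t] are the two coordinates of a point.  The box
    is half-open so that both ends of each column round in the same way. *)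
Section Rectangle.
Variables (R : realType) (p q A B N T c d x0 y0 : R).
Variables (s : seq nat) (X Y : nat -> int) (u t : nat -> R) (P P' : nat -> nat).

Definition codirected i j := u i < u j /\ t i < t j \/ u j < u i /\ t j < t i.
Definition contradirected i j := u i < u j /\ t j < t i \/ u j < u i /\ t i < t j.

Hypotheses (p0 : 0 < p) (pq : p < q) (B0 : 0 < B) (BA : B < A)
  (det1 : p * B + q * A = 1)
  (NE : N = x0 * p + y0 * q) (TE : T = x0 * A + y0 * B) (x00 : 0 <= x0).
Hypotheses (uE : {in s, forall i, u i = (X i)%:~R * p + (Y i)%:~R * q})
           (tE : {in s, forall i, t i = (X i)%:~R * A - (Y i)%:~R * B}).
Hypothesis us : uniq s.
Hypothesis XY_inj : {in s &, forall i j, X i = X j -> Y i = Y j -> i = j}.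
Hypothesis in_box : {in s, forall i, c <= u i < c + N /\ d < t i <= d + T}.
Hypothesis box_in : forall x y : int,
  c <= x%:~R * p + y%:~R * q < c + N -> d < x%:~R * A - y%:~R * B <= d + T ->
  exists i, [/\ i \in s, X i = x & Y i = y].
Hypothesis dual : forall k m, (P k + P' m <= size s + k * m)%N.
Hypothesis co_bound : forall k (f : nat -> nat),
  {in s &, forall i j, i != j -> (f i < k)%N -> f i = f j -> codirected i j} ->
  (count (fun i => f i < k)%N s <= P k)%N.
Hypothesis contra_bound : forall k (f : nat -> nat),
  {in s &, forall i j, i != j -> (f i < k)%N -> f i = f j -> contradirected i j} ->
  (count (fun i => f i < k)%N s <= P' k)%N.

Let rho := A / B.
Let sigma := p / q.
(* [(xi, eta)] is the left vertex of the inscribed parallelogram *)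
Let xi := c * B + (d + y0 * B) * q.
Let eta := c * A - (d + y0 * B) * p.
Let lo (x : int) := eta + strip_lower rho sigma x0 (x%:~R - xi).
Let hi (x : int) := eta + strip_upper rho sigma x0 y0 (x%:~R - xi).
Let height x := count (fun i => X i == x) s.

Let q0 : 0 < q. Proof. exact: lt_trans pq. Qed.
Let sigma0 : 0 < sigma. Proof. exact: divr_gt0. Qed.
Let sigma1 : sigma < 1. Proof. by rewrite ltr_pdivrMr // mul1r. Qed.
Let rho1 : 1 < rho. Proof. by rewrite ltr_pdivlMr // mul1r. Qed.
Let slopes : (rho + sigma)^-1 = q * B.
Proof.
apply: (@mulIf _ (rho + sigma)); first by rewrite gt_eqF // addr_gt0 // (lt_trans ltr01).
rewrite mulVf; last by rewrite gt_eqF // addr_gt0 // (lt_trans ltr01).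
rewrite -det1 /rho /sigma; field; by rewrite !gt_eqF.
Qed.
Let pE : p = sigma * q. Proof. by rewrite /sigma divfK // gt_eqF. Qed.
Let AE : A = rho * B. Proof. by rewrite /rho divfK // gt_eqF. Qed.

Lemma box_strip (x y : int) :
  (c <= x%:~R * p + y%:~R * q < c + N) && (d < x%:~R * A - y%:~R * B <= d + T)
  = (lo x <= y%:~R < hi x).
Proof.
have cE : c = xi * p + eta * q.
  by rewrite -[LHS]mulr1 -det1 /xi /eta; ring.
have dE : d = xi * A - eta * B - y0 * B.
  have <- : d + y0 * B = xi * A - eta * B by rewrite -[LHS]mulr1 -det1 /xi /eta; ring.
  by rewrite addrK.
rewrite /lo /hi /strip_lower /strip_upper.
set D := x%:~R - xi; have -> : x%:~R = xi + D by rewrite /D addrC subrK.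
set z := y%:~R.
have e1 : (c <= (xi + D) * p + z * q) = (eta + - sigma * D <= z).
  rewrite -subr_ge0 -[RHS]subr_ge0 cE [in LHS]pE.
  have -> : (xi + D) * (sigma * q) + z * q - (xi * (sigma * q) + eta * q)
    = (z - (eta + - sigma * D)) * q by ring.
  by rewrite pmulr_lge0.
have e2 : ((xi + D) * A - z * B <= d + T) = (eta + rho * (D - x0) <= z).
  rewrite -subr_ge0 -[RHS]subr_ge0 dE TE [in LHS]AE.
  have -> : xi * (rho * B) - eta * B - y0 * B + (x0 * (rho * B) + y0 * B) -
    ((xi + D) * (rho * B) - z * B) = (z - (eta + rho * (D - x0))) * B by ring.
  by rewrite pmulr_lge0.
have e3 : ((xi + D) * p + z * q < c + N) = (z < eta + (y0 + sigma * (x0 - D))).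
  rewrite -subr_gt0 -[RHS]subr_gt0 cE NE [in LHS]pE.
  have -> : xi * (sigma * q) + eta * q + (x0 * (sigma * q) + y0 * q) -
    ((xi + D) * (sigma * q) + z * q) = (eta + (y0 + sigma * (x0 - D)) - z) * q by ring.
  by rewrite pmulr_lgt0.
have e4 : (d < (xi + D) * A - z * B) = (z < eta + (y0 + rho * D)).
  rewrite -subr_gt0 -[RHS]subr_gt0 dE [in LHS]AE.
  have -> : (xi + D) * (rho * B) - z * B - (xi * (rho * B) - eta * B - y0 * B)
    = (eta + (y0 + rho * D) - z) * B by ring.
  by rewrite pmulr_lgt0.
rewrite e1 e2 e3 e4 addr_maxr addr_minr addr_minr ge_max lt_min.
by rewrite !andbA; do 4 case: (_ <= _) || case: (_ < _).
Qed.

Let strip_in x y : lo x <= y%:~R < hi x -> exists i, [/\ i \in s, X i = x & Y i = y].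
Proof. by rewrite -box_strip => /andP[h1 h2]; apply: box_in. Qed.

Let in_strip i : i \in s -> lo (X i) <= (Y i)%:~R < hi (X i).
Proof.
move=> si; have [h1 /andP[h2 h3]] := in_box si.
by rewrite -box_strip -uE // -tE // h1 h2.
Qed.

(** The colour of a point is its rank in the window of its column. *)
Lemma attained_below k : k%:R < y0 -> attained X s P k.
Proof.
move=> ky.
have [th [g0 [th0 th1 H]]] := strip_line sigma0 sigma1 rho1 x00 ky.
pose w (x : int) := Num.ceil (eta + g0 + th * (x%:~R - xi)).
have slope x x' : x < x' -> 0 <= w x' - w x /\ (w x' - w x)%:~R < rho * (x' - x)%:~R.
  move=> xx'.
  have := @ceil_slope R rho sigma th (eta + g0 + th * (x%:~R - xi)) (x' - x) sigma0 rho1 th0 th1.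
  rewrite subr_gt0 xx' => /(_ isT); rewrite /w.
  by have -> : eta + g0 + th * (x%:~R - xi) + th * (x' - x)%:~R = eta + g0 + th * (x'%:~R - xi)
    by rewrite intrB; ring.
pose f i := if w (X i) <= Y i < w (X i) + k%:Z then `|Y i - w (X i)|%N else k.
have fk i : (f i < k)%N -> Y i = w (X i) + (f i)%:Z.
  rewrite /f; case: ifP => [/andP[h1 h2] _|_]; last by rewrite ltnn.
  by rewrite gez0_abs ?subr_ge0 // addrCA subrr addr0.
exists f.
  apply: co_bound => i j si sj neq fik feq.
  have Yi := fk i fik; have := fik; rewrite feq => /fk Yj.
  wlog lt : i j si sj neq fik feq Yi Yj / X i < X j.
    move=> W; case: (ltrgtP (X i) (X j)) => [|lt|eqX]; first exact: W.
      have := W j i sj si _ _ (esym feq) Yj Yi lt; rewrite eq_sym -feq => /(_ neq fik).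
      by case; [right|left].
    by move: neq; rewrite (XY_inj si sj eqX) ?eqxx // Yi Yj eqX feq.
  have [m0 m1] := slope _ _ lt.
  left; rewrite !uE // !tE // Yi Yj feq.
  move: m0 m1; rewrite -(ler0z R) !intrD !intrN; set wi := (w (X i))%:~R; set wj := (w (X j))%:~R => m0 m1.
  have : (X i)%:~R < (X j)%:~R :> R by rewrite ltr_int.
  set xi' := (X i)%:~R; set xj := (X j)%:~R => ltX.
  have h1 : 0 < (xj - xi') * p by rewrite mulr_gt0 // subr_gt0.
  have h2 : 0 <= (wj - wi) * q by rewrite mulr_ge0 // ltW.
  have h3 : 0 < (rho * (xj - xi') - (wj - wi)) * B by rewrite mulr_gt0 // subr_gt0.
  by split; [lra|rewrite [A]AE; lra].
move=> i si; have /= := H ((X i)%:~R - xi).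
have fkT j : X j = X i -> w (X i) <= Y j < w (X i) + k%:Z -> (f j < k)%N.
  move=> Xj wj; rewrite /f Xj wj; case/andP: wj => h1 h2.
  by rewrite -ltz_nat gez0_abs ?subr_ge0 // ltrBlDl.
case: ifP => _ /andP[h1 h2]; last first.
  (* the window contains the column *)
  apply: leq_trans (geq_minr _ _) _; apply: eq_leq; apply: eq_in_count => j sj /=.
  case: eqP => // Xj; have := in_strip sj; rewrite Xj => /andP[l1 l2]; rewrite fkT //.
  apply/andP; split.
    by rewrite ceil_le_int; apply: le_trans l1; rewrite /lo -addrA lerD2l.
  rewrite -(ltr_int R) intrD; apply: lt_le_trans l2 _; rewrite -lerBlDr.
  by apply: le_trans (ceil_ge _); move: h1; rewrite /hi -[k%:~R]/(k%:R); lra.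
(* the window lies in the column *)
apply: leq_trans (geq_minl _ _) _.
rewrite -size_filter -(size_map Y) -[X in (X <= _)%N](size_iota 0 k).
rewrite -(size_map (fun j : nat => w (X i) + j%:Z)); apply: uniq_leq_size.
  by rewrite map_inj_uniq ?iota_uniq // => a b /addrI [].
move=> y /mapP[j]; rewrite mem_iota add0n => /andP[_ jk] ->.
have [|i' [si' Xi' Yi']] := @strip_in (X i) (w (X i) + j%:Z).
  rewrite intrD; apply/andP; split.
    apply: le_trans (_ : (w (X i))%:~R <= _); last by rewrite lerDl ler0z.
    by apply: le_trans (ceil_ge _); move: h1; rewrite /lo; lra.
  have := ceilB1_lt (eta + g0 + th * ((X i)%:~R - xi)); rewrite -/(w (X i)) intrB.
  have : (j%:R + 1 <= k%:R :> R) by rewrite -[X in _ + X]/(1%:R) -natrD addn1 ler_nat.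
  rewrite /hi -[j%:~R]/(j%:R); lra.
apply/mapP; exists i' => //; rewrite mem_filter si' Xi' eqxx andbT /=; apply: fkT => //.
by rewrite Yi' lerDl ltrD2l ltz_nat jk.
Qed.

(** A half-open interval of length [k] contains at least [k] integers. *)
Lemma le_height (k : nat) x :
  - ((y0 - k%:R) * (q * B)) <= x%:~R - xi <= x0 + (y0 - k%:R) * (q * B) ->
  k%:R < y0 -> (k <= height x)%N.
Proof.
rewrite -slopes => dx ky.
have [th [g0 [_ _ /(_ (x%:~R - xi))]]] := strip_line sigma0 sigma1 rho1 x00 ky.
rewrite /= dx => /andP[h1 h2].
have : hi x - lo x - 1 < (height x)%:R.
  rewrite /height -size_filter -(size_map Y); apply: size_ints_gt => y /strip_in[i [si Xi <-]].
  by apply: map_f; rewrite mem_filter Xi eqxx.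
move=> h3; rewrite -ltnS -(ltr_nat R) -addn1 natrD; move: h3; rewrite /hi /lo; lra.
Qed.

(** A column with [k] points has length more than [k - 1], hence the additional
    unit of [y0 - k + 1]. *)
Lemma height_le (k : nat) x : (0 < k)%N -> (k <= height x)%N ->
  - ((y0 - k%:R + 1) * (q * B)) < x%:~R - xi < x0 + (y0 - k%:R + 1) * (q * B).
Proof.
move=> k0 kx.
have uc : uniq (map Y [seq i <- s | X i == x]).
  rewrite map_inj_in_uniq ?filter_uniq // => i j.
  rewrite !mem_filter => /andP[/eqP Xi si] /andP[/eqP Xj sj]; apply: XY_inj => //.
  by rewrite Xi Xj.
have inc : {in map Y [seq i <- s | X i == x], forall z : int, lo x <= z%:~R < hi x}.
  by move=> z /mapP[i]; rewrite mem_filter => /andP[/eqP <- si] ->; apply: in_strip.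
have lohi : lo x <= hi x.
  have : has (fun i => X i == x) s by rewrite has_count (leq_trans k0).
  case/hasP => i si /eqP Xi; have := in_strip si; rewrite Xi => /andP[h1 /ltW]; exact: le_trans.
have := size_ints_lt lohi uc inc; rewrite size_map size_filter -/(height x) => lt.
rewrite -slopes (_ : y0 - k%:R + 1 = y0 - (k%:R - 1)); last by ring.
apply: strip_height_gt => //.
have : k%:R <= (height x)%:R :> R by rewrite ler_nat.
by move: lt; rewrite /hi /lo; lra.
Qed.

(** By [fibre_diff] the difference counts the columns with at least [k] points.
    They include all integers of an interval of length
    [x0 + 2 * (y0 - k) * (q * B)] and lie in one that is longer by
    [2 * (q * B)]. *)
Lemma part_estimate (k : nat) : (0 < k)%N -> k%:R <= y0 - 1 ->
  `|(P k)%:R - (P k.-1)%:R - (q * T + B * N) + 2 * k%:R * (q * B)| <= 1 + 2 * (q * B).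
Proof.
case: k => // k _ ky /=.
have ky1 : k.+1%:R < y0 by lra.
have ky0 : k%:R < y0 by apply: le_lt_trans ky1; rewrite ler_nat.
have bound m (f : nat -> nat) : {in s &, forall i j, (f i < m)%N -> f i = f j -> X i = X j} ->
    (count (fun i => f i < m)%N s <= P' m)%N.
  move=> H; apply: contra_bound => i j si sj neq fi fij; have eqX := H i j si sj fi fij.
  have neqY : Y i != Y j by apply: contraNneq neq => eqY; apply/eqP/XY_inj.
  rewrite /contradirected !uE // !tE // eqX !ltrD2l !ltrN2 !ltr_pM2r // ltr_int ltr_int.
  by case: (ltrgtP (Y i) (Y j)) neqY => //; [left|right].
have := fibre_diff dual bound (attained_below ky0) (attained_below ky1).
set cols := undup _; set tall := count _ _ => E.
have -> : (P k.+1)%:R - (P k)%:R = tall%:R :> R by rewrite -E natrD addrAC subrr add0r.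
set L := x0 + 2 * (y0 - k.+1%:R) * (q * B).
have qB0 : 0 < q * B by rewrite mulr_gt0.
have LE : q * T + B * N - 2 * k.+1%:R * (q * B) = L.
  rewrite TE NE /L.
  have -> : x0 + 2 * (y0 - k.+1%:R) * (q * B) = x0 * (p * B + q * A) + 2 * (y0 - k.+1%:R) * (q * B).
    by rewrite det1 mulr1.
  ring.
have tallE : tall = size [seq x <- cols | (k < height x)%N] by rewrite size_filter.
have lower_count : L - 1 < tall%:R.
  rewrite tallE.
  have -> : L = (xi + (x0 + (y0 - k.+1%:R) * (q * B))) - (xi - (y0 - k.+1%:R) * (q * B)).
    by rewrite /L; ring.
  apply: size_ints_gt => z /andP[z1 z2].
  have kz : (k < height z)%N.
    by apply: le_height => //; apply/andP; split; lra.
  rewrite mem_filter kz mem_undup.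
  have : has (fun i => X i == z) s by rewrite has_count (leq_trans _ kz).
  by case/hasP => i si /eqP <-; apply: map_f.
have upper_count : tall%:R < L + 2 * (q * B) + 1.
  rewrite tallE.
  have -> : L + 2 * (q * B)
    = (xi + (x0 + (y0 - k.+1%:R + 1) * (q * B))) - (xi - (y0 - k.+1%:R + 1) * (q * B)).
    by rewrite /L; ring.
  have h0 : 0 <= (y0 - k.+1%:R + 1) * (q * B) by rewrite mulr_ge0 //; [lra|exact: ltW].
  have x00' := x00.
  apply: size_ints_lt; [lra|by rewrite filter_uniq ?undup_uniq|].
  move=> z; rewrite mem_filter => /andP[kz _]; have /andP[h1 h2] := height_le (ltn0Sn k) kz.
  by apply/andP; split; lra.
by rewrite ler_norml; apply/andP; split; lra.
Qed.
End Rectangle.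

(** * Convergents *)

(** Shifted by two: with [(u, v) = (0, 1)] and [(1, 0)] the term of index [k + 2]
    is the numerator and the denominator of the [k]-th convergent. *)
Fixpoint continuant (a : nat -> int) (u v : int) (k : nat) : int :=
  if k is k'.+1 then
    if k' is k''.+1 then a k'' * continuant a u v k' + continuant a u v k'' else v
  else u.

Lemma continuantSS a u v k :
  continuant a u v k.+2 = a k * continuant a u v k.+1 + continuant a u v k.
Proof. by []. Qed.

Section Continuants.
Variable a : nat -> int.
Hypotheses (a_ge0 : forall k, 0 <= a k) (a_gt0 : forall k, (0 < k)%N -> 0 < a k).
Let pn := continuant a 0 1.
Let qn := continuant a 1 0.

Lemma continuant_det k : pn k.+1 * qn k - pn k * qn k.+1 = (-1) ^+ k.
Proof.
elim: k => [|k IH]; first by rewrite /pn /qn /= mulr1 mul0r subr0.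
rewrite exprS -IH /pn /qn !continuantSS -/pn -/qn; ring.
Qed.

Lemma continuant_gt0 k : 0 < qn k.+2 /\ 0 <= qn k.+1.
Proof.
elim: k => [|k [IH1 IH2]]; first by rewrite /qn /= mulr0 add0r.
split; last exact: ltW.
by rewrite /qn continuantSS -/qn; have := mulr_gt0 (a_gt0 (ltn0Sn k)) IH1; lia.
Qed.

Lemma continuant_lt k : qn k.+3 < qn k.+4.
Proof.
have [h1 _] := continuant_gt0 k.+1; have [h2 _] := continuant_gt0 k.
rewrite /qn [X in _ < X]continuantSS -/qn.
by have := a_gt0 (ltn0Sn k.+1); nia.
Qed.

Lemma cfrac_rcons s x : cfrac (rcons s x) = foldr (fun b y => b%:~R + y^-1) x%:~R s.
Proof.
elim: s => //= b s IH; rewrite -IH.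
by case: s {IH} => [|c s].
Qed.

(** Replacing the last partial quotient by any positive [x] allows an induction
    that extends the continued fraction at its end. *)
Lemma fold_continuant k (x : rat) : (k == 0)%N || (0 < x) ->
  foldr (fun b y => b%:~R + y^-1) x (mkseq a k) =
  ((pn k.+1)%:~R * x + (pn k)%:~R) / ((qn k.+1)%:~R * x + (qn k)%:~R).
Proof.
elim: k x => [|k IH] x; first by rewrite /pn /qn /= mul1r mul0r add0r addr0 divr1.
move=> /orP[//|x0]; rewrite mkseqS foldr_rcons IH; last first.
  by rewrite ltr_wpDl ?orbT ?invr_gt0 // ler0z.
have xn0 : x != 0 by rewrite gt_eqF.
have scale (u v b : int) : u%:~R * (b%:~R + x^-1) + v%:~R
    = ((b * u + v)%:~R * x + u%:~R) / x :> rat.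
  by rewrite intrD intrM; field.
by rewrite !scale invf_div mulrA divfK // /pn /qn !continuantSS.
Qed.
End Continuants.

Section Convergents.
Variables (R : realType) (alpha : R).
Hypotheses (alpha_gt0 : 0 < alpha) (alpha_irr : irrational alpha).
Let a := partial_quotient alpha.
Let z := complete_quotient alpha.

Definition cv_num k := continuant a 0 1 k.+2.
Definition cv_den k := continuant a 1 0 k.+2.

Lemma complete_quotient_irr k : irrational (z k).
Proof.
elim: k => [//|k IH]; rewrite /z /= => -[r _ rE]; apply: IH.
exists ((Num.floor (z k))%:~R + r^-1) => //.
by rewrite rmorphD fmorphV /= rE ratr_int invrK addrC subrK.
Qed.

Lemma complete_quotient_gt1 k : 1 < z k.+1.
Proof.
rewrite /z /= -/(z k); have /andP[h1 h2] := floor_itv (z k).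
have ne : z k != (Num.floor (z k))%:~R.
  apply/eqP => E; apply: (@complete_quotient_irr k); exists (Num.floor (z k))%:~R => //.
  by rewrite ratr_int -E.
have h : 0 < z k - (Num.floor (z k))%:~R by rewrite subr_gt0 lt_neqAle eq_sym ne.
by rewrite invf_gt1 //; move: h2; rewrite intrD; lra.
Qed.

Lemma complete_quotientE k : z k = (a k)%:~R + (z k.+1)^-1.
Proof. by rewrite /z /= invrK addrC subrK. Qed.

Lemma partial_quotient_ge0 k : 0 <= a k.
Proof.
rewrite /a /partial_quotient floor_ge0 ?num_real //; case: k => [|k]; first exact: ltW.
exact/ltW/(lt_trans ltr01)/complete_quotient_gt1.
Qed.

Lemma partial_quotient_gt0 k : (0 < k)%N -> 0 < a k.
Proof.
case: k => // k _; rewrite /a /partial_quotient floor_gt0 .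
exact/ltW/complete_quotient_gt1.
Qed.

Definition cv_gap k : R := (cv_den k)%:~R * alpha - (cv_num k)%:~R.

(** Up to sign the complete quotients are the ratios of successive values of
    [q * alpha - p]; this gives at once the alternation of signs and the decrease
    of the absolute values. *)
Lemma gap_recursion k :
  (continuant a 1 0 k)%:~R * alpha - (continuant a 0 1 k)%:~R =
  - z k * ((continuant a 1 0 k.+1)%:~R * alpha - (continuant a 0 1 k.+1)%:~R).
Proof.
elim: k => [|k IH]; first by rewrite /= /z /=; ring.
have z0 : z k.+1 != 0 by rewrite gt_eqF // (lt_trans ltr01) ?complete_quotient_gt1.
rewrite !continuantSS !intrD !intrM; move: IH; rewrite complete_quotientE.
set q1 := (continuant a 1 0 k.+1)%:~R; set p1 := (continuant a 0 1 k.+1)%:~R.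
set q2 := (continuant a 1 0 k)%:~R; set p2 := (continuant a 0 1 k)%:~R => IH.
have -> : ((a k)%:~R * q1 + q2) * alpha - ((a k)%:~R * p1 + p2)
  = (a k)%:~R * (q1 * alpha - p1) + (q2 * alpha - p2) by ring.
by rewrite IH; field.
Qed.

Lemma cv_gapE k : cv_gap k = - z k.+2 * cv_gap k.+1.
Proof. exact: gap_recursion. Qed.

Lemma gap_sign k : 0 < (-1) ^+ k * cv_gap k.
Proof.
elim: k => [|k IH].
  have := gap_recursion 1; rewrite -/(cv_gap 0) /= mul0r sub0r mulNr => /eqP.
  rewrite eqr_opp => /eqP E; rewrite expr0 mul1r.
  by rewrite -(pmulr_rgt0 _ (lt_trans ltr01 (complete_quotient_gt1 0))) -E.
have z0 := lt_trans ltr01 (complete_quotient_gt1 k.+1).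
rewrite -(pmulr_rgt0 _ z0) exprS; move: IH; rewrite cv_gapE.
by have -> : (-1) ^+ k * (- z k.+2 * cv_gap k.+1) = z k.+2 * (-1 * (-1) ^+ k * cv_gap k.+1) by ring.
Qed.

Lemma gap_lt k : (-1) ^+ k.+1 * cv_gap k.+1 < (-1) ^+ k * cv_gap k.
Proof.
have := gap_sign k.+1; set e := _ * _ => e0.
have -> : (-1) ^+ k * cv_gap k = z k.+2 * e.
  by rewrite /e cv_gapE exprS; ring.
by rewrite ltr_pMl // complete_quotient_gt1.
Qed.

Lemma cv_den_gt0 k : 0 < cv_den k.
Proof. by have [] := continuant_gt0 partial_quotient_gt0 k. Qed.

(** The recursion runs through the positive partial quotients only; the first
    one may be [0], and is covered by the base case. *)
Lemma convergentE k : convergent alpha k = (cv_num k)%:~R / (cv_den k)%:~R.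
Proof.
rewrite /convergent mkseqS cfrac_rcons (fold_continuant partial_quotient_ge0).
  by rewrite /cv_num /cv_den !continuantSS !intrD !intrM; congr (_ / _); ring.
by case: k => //= k; rewrite ltr0z partial_quotient_gt0.
Qed.

Lemma cv_coprime k : coprime `|cv_num k| `|cv_den k|.
Proof.
have := continuant_det a k.+1; rewrite -/(cv_num k) -/(cv_den k) => det.
rewrite -coprimezE; apply/coprimezP.
exists ((-1) ^+ k.+1 * continuant a 1 0 k.+1, - (-1) ^+ k.+1 * continuant a 0 1 k.+1) => /=.
rewrite -[RHS](sqrr_sign _ k.+1) expr2 -[X in _ = _ * X]det; ring.
Qed.

Lemma conv_denE k : conv_den alpha k = (cv_den k)%:~R.
Proof.
rewrite /conv_den convergentE (coprimeq_den (cv_coprime k)).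
by rewrite gt_eqF ?cv_den_gt0 // gtr0_norm ?cv_den_gt0.
Qed.

Lemma conv_numE k : conv_num alpha k = (cv_num k)%:~R.
Proof.
by rewrite /conv_num convergentE (coprimeq_num (cv_coprime k)) gtr0_sg ?cv_den_gt0 ?mul1r.
Qed.

Lemma conv_errE k : conv_den alpha k * conv_err alpha k = (-1) ^+ k * cv_gap k.
Proof.
have q0 : 0 < (cv_den k)%:~R :> R by rewrite ltr0z cv_den_gt0.
rewrite /conv_err conv_denE conv_numE -{1}(gtr0_norm q0) -normrM mulrBr mulrCA divff ?gt_eqF // mulr1.
rewrite -/(cv_gap k) -(gtr0_norm (gap_sign k)) normrM normrX normrN1 expr1n mul1r //.
Qed.

Lemma cv_det k : cv_num k.+1 * cv_den k - cv_num k * cv_den k.+1 = (-1) ^+ k.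
Proof. by rewrite (continuant_det a k.+2) !exprS; ring. Qed.

Lemma cv_den_lt k : (0 < k)%N -> cv_den k < cv_den k.+1.
Proof. by case: k => // k _; apply: continuant_lt partial_quotient_gt0 k. Qed.
End Convergents.

(** * The lattice of the points [(i, f i)] *)

Lemma conj_part_count (l : seq nat) k : sorted geq l -> (0 < k)%N ->
  part (conj_part l) k = count (fun r => k.-1 < r)%N l.
Proof.
case: k => // k sl _; rewrite /part /conj_part /=.
case: (ltnP k (head 0%N l)) => kl; first by rewrite nth_mkseq.
rewrite nth_default ?size_mkseq //; apply/esym/eqP; rewrite -leqn0 leqNgt -has_count.
apply/hasPn => r rl; rewrite -leqNgt; apply: leq_trans kl.
case: l sl rl => // a l; rewrite /= (path_sortedE geq_trans) => /andP[/allP al _].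
by rewrite inE => /predU1P[->//|/al].
Qed.

Lemma sum_minn_diff (l : seq nat) k :
  (\sum_(r <- l) minn k.+1 r = \sum_(r <- l) minn k r + count (fun r => k < r) l)%N.
Proof.
rewrite -sum1_count [X in (_ + X)%N]big_mkcond -big_split /=; apply: eq_bigr => r _.
by case: (ltnP k r); lia.
Qed.

Lemma int_le_nat (R : realType) (z : int) (n : nat) : z%:~R < 1 + n%:R :> R -> z%:~R <= n%:R :> R.
Proof.
have -> : 1 + n%:R = (n%:Z + 1)%:~R :> R by rewrite intrD addrC.
by rewrite -[n%:R]/(n%:Z%:~R) ltr_int ler_int ltzD1.
Qed.

Section Word.
Variables (R : realType) (alpha : R) (n : nat).
Hypothesis alpha_irr : irrational alpha.
Let s := perm_word (sorting_perm n alpha).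

Lemma mem_word i : (i \in s) = (0 < i <= n)%N.
Proof.
apply/mapP/idP => [[j _ ->]|/andP[i0 le]]; first by rewrite ltn_ord.
have lt : (i.-1 < n)%N by rewrite prednK.
exists ((sorting_perm n alpha)^-1%g (Ordinal lt)); first by rewrite mem_enum.
by rewrite permKV /= prednK.
Qed.

Lemma uniq_word : uniq s.
Proof. by rewrite map_inj_uniq ?enum_uniq // => i j /succn_inj/val_inj/perm_inj. Qed.

Lemma word_increasing : pairwise (fun i j => fracpart alpha i < fracpart alpha j) s.
Proof.
rewrite pairwise_map; have /forallP srt := sorting_permP n alpha_irr.
have := iota_ltn_sorted 0 n; rewrite -val_enum_ord sorted_map sorted_pairwise; last first.
  by move=> b a c; apply: ltn_trans.
apply: sub_pairwise => i j /= ij.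
by have /forallP/(_ j)/implyP := srt i; apply.
Qed.

Lemma directed_colouring (D : nat -> nat -> Prop) (e : rel nat) k (f : nat -> nat) :
  {in s &, forall i j, fracpart alpha i < fracpart alpha j -> D i j -> e i j} ->
  {in s &, forall i j, i != j -> (f i < k)%N -> f i = f j -> D i j} -> colouring e k f s.
Proof.
move=> De H; apply: sub_pairwise_mem word_increasing => i j si sj lt.
apply/implyP => /andP[fk /eqP fij]; apply: De => //; apply: H => //.
by apply: contraTneq lt => ->; rewrite ltxx.
Qed.

Let lambda := sh (sorting_perm n alpha).

Lemma rows_dual k m :
  (\sum_(i < k) nth 0%N lambda i + \sum_(r <- lambda) minn m r <= size s + k * m)%N.
Proof. by rewrite -(sumn_shape uniq_word); apply: greene_duality. Qed.

Lemma cols_dual k m :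
  (\sum_(r <- lambda) minn k r + \sum_(i < m) nth 0%N lambda i <= size s + k * m)%N.
Proof. by rewrite addnC mulnC; apply: rows_dual. Qed.

Lemma row_part k : (0 < k)%N -> (part lambda k)%:R =
  (\sum_(i < k) nth 0%N lambda i)%:R - (\sum_(i < k.-1) nth 0%N lambda i)%:R :> R.
Proof. by case: k => // k _; rewrite big_ord_recr /= natrD addrAC subrr add0r. Qed.

Lemma col_part k : (0 < k)%N -> (part (conj_part lambda) k)%:R =
  (\sum_(r <- lambda) minn k r)%:R - (\sum_(r <- lambda) minn k.-1 r)%:R :> R.
Proof.
move=> k0; rewrite conj_part_count //; last exact: sorted_shape uniq_word.
by case: k k0 => // k _; rewrite sum_minn_diff natrD addrAC subrr add0r.
Qed.

Lemma rows_bound (D : nat -> nat -> Prop) :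
  {in s &, forall i j, fracpart alpha i < fracpart alpha j -> D i j -> (i < j)%N} ->
  forall k (f : nat -> nat),
  {in s &, forall i j, i != j -> (f i < k)%N -> f i = f j -> D i j} ->
  (count (fun i => f i < k)%N s <= \sum_(i < k) nth 0%N lambda i)%N.
Proof. by move=> De k f H; apply: greene_inc uniq_word _ _ (directed_colouring De H). Qed.

Lemma cols_bound (D : nat -> nat -> Prop) :
  {in s &, forall i j, fracpart alpha i < fracpart alpha j -> D i j -> (j < i)%N} ->
  forall k (f : nat -> nat),
  {in s &, forall i j, i != j -> (f i < k)%N -> f i = f j -> D i j} ->
  (count (fun i => f i < k)%N s <= \sum_(r <- lambda) minn k r)%N.
Proof. by move=> De k f H; apply: greene_dec uniq_word _ _ (directed_colouring De H). Qed.

(** The determinant makes [(qa, pa)], [(qb, pb)] a basis of the integer lattice;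
    [(X i, Y i)] are the coordinates of [(i, floor (alpha * i))] in it. *)
Section Lattice.
Variables (pa pb qa qb : int).
Hypothesis det1 : pb * qa - pa * qb = 1.
Let a : R := qa%:~R * alpha - pa%:~R.
Let b : R := pb%:~R - qb%:~R * alpha.
Let X (i : nat) : int := i%:Z * pb - Num.floor (alpha * i%:R) * qb.
Let Y (i : nat) : int := Num.floor (alpha * i%:R) * qa - i%:Z * pa.

Lemma lattice_index i : (X i)%:~R * qa%:~R + (Y i)%:~R * qb%:~R = i%:R :> R.
Proof.
rewrite -!intrM -intrD /X /Y.
have -> : (i%:Z * pb - Num.floor (alpha * i%:R) * qb) * qa +
  (Num.floor (alpha * i%:R) * qa - i%:Z * pa) * qb = i%:Z * (pb * qa - pa * qb) by ring.
by rewrite det1 mulr1.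
Qed.

Lemma lattice_frac i : (X i)%:~R * a - (Y i)%:~R * b = fracpart alpha i.
Proof.
have det1R : pb%:~R * qa%:~R - pa%:~R * qb%:~R = 1 :> R by rewrite -!intrM -intrB det1.
rewrite /X /Y /a /b /fracpart !intrB !intrM -[i%:Z%:~R]/(i%:R).
set m := (Num.floor _)%:~R.
have -> : (i%:R * pb%:~R - m * qb%:~R) * (qa%:~R * alpha - pa%:~R) -
  (m * qa%:~R - i%:R * pa%:~R) * (pb%:~R - qb%:~R * alpha)
  = (alpha * i%:R - m) * (pb%:~R * qa%:~R - pa%:~R * qb%:~R) by ring.
by rewrite det1R mulr1.
Qed.

Lemma frac_bounds i : (0 < i)%N -> 0 < fracpart alpha i < 1.
Proof.
move=> i0; rewrite /fracpart; have /andP[h1 h2] := floor_itv (alpha * i%:R).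
move: h2; rewrite intrD -ltrBlDl => ->; rewrite andbT subr_gt0 lt_neqAle h1 andbT.
apply/eqP => E; apply: alpha_irr; exists ((Num.floor (alpha * i%:R))%:~R / i%:R) => //.
by rewrite fmorph_div /= ratr_int E ratr_nat mulfK // pnatr_eq0 -lt0n.
Qed.

(** Both bounds on the height may be large inequalities, as no positive multiple
    of [alpha] is an integer. *)
Lemma lattice_box (x y : int) :
  0 < x%:~R * qa%:~R + y%:~R * qb%:~R :> R -> x%:~R * qa%:~R + y%:~R * qb%:~R <= n%:R :> R ->
  0 <= x%:~R * a - y%:~R * b <= 1 -> exists i, [/\ i \in s, X i = x & Y i = y].
Proof.
rewrite -!intrM -intrD ltr0z -[n%:R]/(n%:~R) ler_int => i0 le_n /andP[t0 t1].
pose i := `|(x * qa + y * qb)%R|%N.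
have iE : i%:Z = x * qa + y * qb by rewrite gez0_abs // ltW.
have i1 : (0 < i)%N by rewrite -ltz_nat iE.
pose m := x * pa + y * pb.
have tE : x%:~R * a - y%:~R * b = alpha * i%:R - m%:~R.
  by rewrite -[i%:R]/(i%:Z%:~R) iE /m /a /b !intrD !intrM; ring.
have ne r : alpha * i%:R - m%:~R != r%:~R.
  apply/eqP => E; apply: alpha_irr; exists ((m + r)%:~R / i%:R) => //.
  rewrite fmorph_div /= ratr_int ratr_nat intrD -E addrC subrK mulfK //.
  by rewrite pnatr_eq0 -lt0n.
have flE : Num.floor (alpha * i%:R) = m.
  apply: floor_def; rewrite intrD; move: t0 t1; rewrite tE => t0 t1.
  have := ne 1; rewrite neq_lt; case/orP; lra.
exists i; rewrite mem_word i1 -lez_nat iE le_n /X /Y flE iE /m; split => //.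
  by rewrite -[RHS]mulr1 -det1; ring.
by rewrite -[RHS]mulr1 -det1; ring.
Qed.

Variables (x0 y0 : R).
Hypotheses (qa0 : 0 < qa%:~R :> R) (qb0 : 0 < qb%:~R :> R) (a0 : 0 < a) (b0 : 0 < b).
Hypotheses (x00 : 0 <= x0) (y00 : 0 <= y0).
Hypotheses (nE : n%:R = x0 * qa%:~R + y0 * qb%:~R) (oneE : 1 = x0 * a + y0 * b).

Let area : qa%:~R * b + qb%:~R * a = 1.
Proof.
transitivity (pb%:~R * qa%:~R - pa%:~R * qb%:~R : R); first by rewrite /a /b; ring.
by rewrite -!intrM -intrB det1.
Qed.

Let XY_inj : {in s &, forall i j, X i = X j -> Y i = Y j -> i = j}.
Proof.
move=> i j _ _ eqX eqY; apply/eqP; rewrite -(eqr_nat R).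
by rewrite -(lattice_index i) -(lattice_index j) eqX eqY.
Qed.

Let YX_inj : {in s &, forall i j, Y i = Y j -> X i = X j -> i = j}.
Proof. by move=> i j si sj eqY eqX; apply: XY_inj. Qed.

Let word_pos i : i \in s -> (0 < i)%N && (i <= n)%N. Proof. by rewrite mem_word. Qed.

Definition row_estimate (k : nat) (q e : R) :=
  `|(part lambda k)%:R - (q + e * n%:R) + 2 * k%:R * (q * e)| <= 1 + 2 * (q * e).
Definition col_estimate (k : nat) (q e : R) :=
  `|(part (conj_part lambda) k)%:R - (q + e * n%:R) + 2 * k%:R * (q * e)| <= 1 + 2 * (q * e).

(** In the next four lemmas the coordinates of [part_estimate] are chosen so that
    its slope conditions hold: the index is the abscissa in the first and the last
    one, and the ordinate in the other two.  The fractional part is negated when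
    the chains to be counted are decreasing. *)
Lemma row_estimate_low : qa%:~R < qb%:~R :> R -> b < a -> forall k,
  (0 < k)%N -> k%:R <= y0 - 1 -> row_estimate k qb%:~R b.
Proof.
move=> qab ba k k0 ky; rewrite /row_estimate row_part //.
have := @part_estimate R qa%:~R qb%:~R a b n%:R 1 1 0 x0 y0 s X Y (fun i => i%:R) (fracpart alpha)
  (fun k => \sum_(i < k) nth 0%N lambda i)%N (fun k => \sum_(r <- lambda) minn k r)%N
  qa0 qab b0 ba area nE oneE x00.
rewrite mulr1; apply => //.
- by move=> i _; rewrite lattice_index.
- by move=> i _; rewrite lattice_frac.
- exact: uniq_word.
- move=> i /word_pos/andP[i0 le_n]; have /andP[f0 f1] := frac_bounds i0.
  by rewrite f0 add0r (ltW f1) ler1n i0 addrC natr1 ltr_nat ltnS le_n.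
- move=> x y /andP[h1 h2] /andP[h3 h4]; apply: lattice_box.
  + exact: lt_le_trans h1.
  + by move: h2; rewrite -!intrM -intrD; apply: int_le_nat.
  + by rewrite ltW //=; move: h4; rewrite add0r.
- exact: rows_dual.
- apply: rows_bound => i j _ _ lt [] [ui tj]; first by rewrite -(ltr_nat R).
  by have := lt_trans lt tj; rewrite ltxx.
- apply: cols_bound => i j _ _ lt [] [ui tj]; last by rewrite -(ltr_nat R).
  by have := lt_trans lt tj; rewrite ltxx.
Qed.

Lemma row_estimate_steep : qb%:~R < qa%:~R :> R -> a < b -> forall k,
  (0 < k)%N -> k%:R <= y0 - 1 -> row_estimate k qb%:~R b.
Proof.
move=> qba ab k k0 ky; rewrite /row_estimate row_part //.
have area' : a * qb%:~R + b * qa%:~R = 1 by apply: etrans area; ring.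
have := @part_estimate R a b qa%:~R qb%:~R 1 n%:R 0 0 x0 y0 s X (fun i => - Y i)
  (fracpart alpha) (fun i => i%:R)
  (fun k => \sum_(i < k) nth 0%N lambda i)%N (fun k => \sum_(r <- lambda) minn k r)%N
  a0 ab qb0 qba area' oneE nE x00.
rewrite mulr1 ![b * qb%:~R]mulrC [b * n%:R + _]addrC; apply => //.
- by move=> i _; rewrite intrN mulNr lattice_frac.
- by move=> i _; rewrite intrN mulNr opprK lattice_index.
- exact: uniq_word.
- by move=> i j si sj eqX /oppr_inj; apply: XY_inj.
- move=> i /word_pos/andP[i0 le_n]; have /andP[f0 f1] := frac_bounds i0.
  by rewrite !add0r f1 (ltW f0) ltr0n i0 ler_nat.
- move=> x y; rewrite !add0r => /andP[h1 h2] /andP[h3 h4].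
  have [|||i [si Xi Yi]] := @lattice_box x (- y).
  + by rewrite intrN mulNr.
  + by rewrite intrN mulNr.
  + by rewrite intrN mulNr opprK h1 ltW.
  by exists i; rewrite Yi opprK.
- exact: rows_dual.
- apply: rows_bound => i j _ _ lt [] [ui tj]; first by rewrite -(ltr_nat R).
  by have := lt_trans lt ui; rewrite ltxx.
- apply: cols_bound => i j _ _ lt [] [ui tj]; first by rewrite -(ltr_nat R).
  by have := lt_trans lt ui; rewrite ltxx.
Qed.

Lemma col_estimate_low : qa%:~R < qb%:~R :> R -> b < a -> forall k,
  (0 < k)%N -> k%:R <= x0 - 1 -> col_estimate k qa%:~R a.
Proof.
move=> qab ba k k0 kx; rewrite /col_estimate col_part //.
have area' : b * qa%:~R + a * qb%:~R = 1 by apply: etrans area; ring.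
have nE' : n%:R = y0 * qb%:~R + x0 * qa%:~R by rewrite nE addrC.
have oneE' : 1 = y0 * b + x0 * a by rewrite oneE addrC.
have := @part_estimate R b a qb%:~R qa%:~R 1 n%:R (-1) 0 y0 x0 s Y (fun i => - X i)
  (fun i => - fracpart alpha i) (fun i => i%:R)
  (fun k => \sum_(r <- lambda) minn k r)%N (fun k => \sum_(i < k) nth 0%N lambda i)%N
  b0 ba qa0 qab area' oneE' nE' y00.
rewrite mulr1 ![a * qa%:~R]mulrC [a * n%:R + _]addrC; apply => //.
- by move=> i _; rewrite intrN mulNr -lattice_frac opprB.
- by move=> i _; rewrite intrN mulNr opprK addrC lattice_index.
- exact: uniq_word.
- by move=> i j si sj eqX /oppr_inj; apply: YX_inj.
- move=> i /word_pos/andP[i0 le_n]; have /andP[f0 f1] := frac_bounds i0.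
  by rewrite add0r addNr oppr_lt0 lerN2 f0 (ltW f1) ltr0n i0 ler_nat.
- move=> y x; rewrite !add0r addNr => /andP[h1 h2] /andP[h3 h4].
  have [|||i [si Xi Yi]] := @lattice_box (- x) y.
  + by rewrite intrN mulNr addrC.
  + by rewrite intrN mulNr addrC.
  + rewrite intrN mulNr -opprD addrC -oppr_le0 opprK ltW //=.
    by rewrite lerNl.
  by exists i; rewrite Xi opprK.
- exact: cols_dual.
- apply: cols_bound => i j _ _ lt [] [ui tj]; last by rewrite -(ltr_nat R).
  by move: ui; rewrite ltrN2 => ui; have := lt_trans lt ui; rewrite ltxx.
- apply: rows_bound => i j _ _ lt [] [ui tj]; last by rewrite -(ltr_nat R).
  by move: ui; rewrite ltrN2 => ui; have := lt_trans lt ui; rewrite ltxx.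
Qed.

Lemma col_estimate_steep : qb%:~R < qa%:~R :> R -> a < b -> forall k,
  (0 < k)%N -> k%:R <= x0 - 1 -> col_estimate k qa%:~R a.
Proof.
move=> qba ab k k0 kx; rewrite /col_estimate col_part //.
have area' : qb%:~R * a + qa%:~R * b = 1 by apply: etrans area; ring.
have nE' : n%:R = y0 * qb%:~R + x0 * qa%:~R by rewrite nE addrC.
have oneE' : 1 = y0 * b + x0 * a by rewrite oneE addrC.
have := @part_estimate R qb%:~R qa%:~R b a n%:R 1 1 (-1) y0 x0 s Y X
  (fun i => i%:R) (fun i => - fracpart alpha i)
  (fun k => \sum_(r <- lambda) minn k r)%N (fun k => \sum_(i < k) nth 0%N lambda i)%N
  qb0 qba a0 ab area' nE' oneE' y00.
rewrite mulr1; apply => //.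
- by move=> i _; rewrite addrC lattice_index.
- by move=> i _; rewrite -lattice_frac opprB.
- exact: uniq_word.
- move=> i /word_pos/andP[i0 le_n]; have /andP[f0 f1] := frac_bounds i0.
  by rewrite ltrN2 f1 addNr oppr_le0 (ltW f0) ler1n i0 addrC natr1 ltr_nat ltnS le_n.
- move=> y x; rewrite addNr => /andP[h1 h2] /andP[h3 h4].
  have [|||i [si Xi Yi]] := @lattice_box x y.
  + by rewrite addrC; apply: lt_le_trans h1.
  + by rewrite addrC; move: h2; rewrite -!intrM -intrD; apply: int_le_nat.
  + by rewrite -oppr_le0 opprB h4 /= -lerN2 opprB ltW.
  by exists i.
- exact: cols_dual.
- apply: cols_bound => i j _ _ lt [] [ui tj]; last by rewrite -(ltr_nat R).
  by move: tj; rewrite ltrN2 => tj; have := lt_trans lt tj; rewrite ltxx.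
- apply: rows_bound => i j _ _ lt [] [ui tj]; first by rewrite -(ltr_nat R).
  by move: tj; rewrite ltrN2 => tj; have := lt_trans lt tj; rewrite ltxx.
Qed.
End Lattice.
End Word.

(** * The estimates for the shape *)

(** [x0] and [y0] are the sides of the parallelogram inscribed in the rectangle
    of width [m] and height [1]. *)
Lemma crossing_point (R : realType) (m qa qb da db : R) (qa0 : 0 < qa) (qb0 : 0 < qb) (dab : da != db) :
  let x0 := (1 - m * db) / (qa * (da - db)) in
  let y0 := (1 - m * da) / (qb * (db - da)) in
  m = x0 * qa + y0 * qb /\ 1 = x0 * (qa * da) + y0 * (qb * db).
Proof.
have h1 : da - db != 0 by rewrite subr_eq0.
have h2 : db - da != 0 by rewrite subr_eq0 eq_sym.
by split; field; rewrite h1 h2 !gt_eqF.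
Qed.

Lemma estimate_lt (R : realType) (l q e m k d : R) : e = q * d -> q * e < 1 ->
  `|l - (q + e * m) + 2 * k * (q * e)| <= 1 + 2 * (q * e) ->
  `|l - q * (1 + m * d) + 2 * k * q ^+ 2 * d| < 4 + 2 * q ^+ 2 * d < 6.
Proof.
move=> eE qe1; have -> : 2 * k * (q * e) = 2 * k * q ^+ 2 * d by rewrite eE; ring.
have -> : q + e * m = q * (1 + m * d) by rewrite eE; ring.
have qeE : q * e = q ^+ 2 * d by rewrite eE; ring.
rewrite -[2 * q ^+ 2 * d]mulrA -qeE => le; apply/andP; split; last by lra.
by apply: le_lt_trans le _; lra.
Qed.

Unset Implicit Arguments.
Set Strict Implicit.
Set Printing Implicit Defensive.

Theorem theorem5 (R : realType) (alpha : R) (n h : nat)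
    (alpha_gt0 : 0 < alpha) (alpha_lt1 : alpha < 1)
    (alpha_irr : irrational alpha)
    (n_gt0 : (0 < n)%N)
    (n_gt_alpha : 1 / alpha < n%:R)
    (n_gt_1alpha : 1 / (1 - alpha) < n%:R) :
  let q := conv_den alpha in
  let delta := conv_err alpha in
  let beta := fun i : nat => (delta i)^-1 in
  let lambda := sh (sorting_perm n alpha) in
  let lambda' := conj_part lambda in
  beta (2 * h)%N <= n%:R < beta (2 * h + 2)%N ->
  let star := if n%:R < beta (2 * h + 1)%N then 0%N else 2%N in
  let a := (2 * h + star)%N in
  let b := (2 * h + 1)%N in
  let x0 := (1 - n%:R * delta b) / (q a * (delta a - delta b)) in
  let y0 := (1 - n%:R * delta a) / (q b * (delta b - delta a)) in
  (forall k : nat, (1 <= k)%N -> k%:R <= y0 - 1 ->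
     `|(part lambda k)%:R - q b * (1 + n%:R * delta b)
        + 2 * k%:R * q b ^+ 2 * delta b|
       < 4 + 2 * q b ^+ 2 * delta b < 6)
  /\
  (forall k : nat, (1 <= k)%N -> k%:R <= x0 - 1 ->
     `|(part lambda' k)%:R - q a * (1 + n%:R * delta a)
        + 2 * k%:R * q a ^+ 2 * delta a|
       < 4 + 2 * q a ^+ 2 * delta a < 6).
Proof.
move=> q delta beta lambda lambda' /andP[n_ge n_lt] star a b x0 y0.
have q0 i : 0 < q i by rewrite /q conv_denE // ltr0z cv_den_gt0.
have gapE i : q i * delta i = (-1) ^+ i * cv_gap alpha i by apply: conv_errE.
have gap0 i : 0 < q i * delta i by rewrite gapE gap_sign.
have delta0 i : 0 < delta i by have := gap0 i; rewrite pmulr_rgt0.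
have gap_dec i : q i.+1 * delta i.+1 < q i * delta i by rewrite !gapE gap_lt.
have beta_lt i : (n%:R < beta i) = (n%:R * delta i < 1).
  by rewrite /beta -[_^-1]mul1r ltr_pdivlMr.
have beta_le i : (beta i <= n%:R) = (1 <= n%:R * delta i).
  by rewrite /beta -[_^-1]mul1r ler_pdivrMr.
rewrite beta_le in n_ge; rewrite beta_lt in n_lt.
have n0 : 0 < n%:R :> R by rewrite ltr0n.
have odd_b : (-1) ^+ b = -1 :> R by rewrite -signr_odd oddD oddM.
have even_a : (-1) ^+ a = 1 :> R.
  by rewrite -signr_odd oddD oddM /star; case: ifP.
have bE : q b * delta b = (cv_num alpha b)%:~R - (cv_den alpha b)%:~R * alpha.
  by rewrite gapE odd_b mulN1r opprB.
have aE : q a * delta a = (cv_den alpha a)%:~R * alpha - (cv_num alpha a)%:~R.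
  by rewrite gapE even_a mul1r.
have qE i : q i = (cv_den alpha i)%:~R by apply: conv_denE.
have [ab_det H] : cv_num alpha b * cv_den alpha a - cv_num alpha a * cv_den alpha b = 1 /\
  ([/\ q a < q b, q b * delta b < q a * delta a, n%:R * delta b < 1 & 1 <= n%:R * delta a] \/
   [/\ q b < q a, q a * delta a < q b * delta b, 1 <= n%:R * delta b & n%:R * delta a < 1]).
  have bS : b = (2 * h).+1 by rewrite /b addn1.
  have sgn : (-1) ^+ (2 * h) = 1 :> int by rewrite exprM sqrrN !expr1n.
  rewrite /a /star beta_lt -/b bS; case: ltrP => nb.
    rewrite addn0; split; first by rewrite cv_det.
    left; split=> //; rewrite !qE ltr_int; case: (posnP h) => [h0|h0]; last first.
      by rewrite cv_den_lt // muln_gt0.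
    (* The first two denominators agree if [alpha > 1 / 2]; then
       [delta b = 1 - alpha], which the last hypothesis on [n] excludes here. *)
    have den0 : cv_den alpha (2 * h) = 1 by rewrite h0 /cv_den /= mulr0 add0r.
    have num0 : cv_num alpha (2 * h) = 0.
      rewrite h0 /cv_num /= mulr1 addr0 /partial_quotient /=; apply: floor_def.
      by rewrite (ltW alpha_gt0) add0r.
    have := cv_det alpha (2 * h); rewrite sgn num0 den0 mulr1 mul0r subr0 => num1.
    have := cv_den_gt0 alpha_irr (2 * h).+1.
    rewrite gtz0_ge1 le_eqVlt => /predU1P[den1|//].
    move: n_gt_1alpha nb; rewrite ltr_pdivrMr ?subr_gt0 // -bS.
    have := bE; rewrite qE bS num1 -den1 !mulr1z !mul1r => ->.
    by move=> h1 h2; have := lt_trans h1 h2; rewrite ltxx.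
  rewrite addn2; split.
    by have := cv_det alpha (2 * h).+1; rewrite exprS sgn; lia.
  right; split=> //; last by rewrite -addn2.
  by rewrite !qE ltr_int cv_den_lt.
have area : q a * (q b * delta b) + q b * (q a * delta a) = 1.
  rewrite aE bE !qE.
  transitivity (((cv_num alpha b * cv_den alpha a - cv_num alpha a * cv_den alpha b)%:~R) : R).
    by rewrite intrB !intrM; ring.
  by rewrite ab_det.
have [small_b small_a] : q b * (q b * delta b) < 1 /\ q a * (q a * delta a) < 1.
  have pos i j : 0 < q i * (q j * delta j) by rewrite mulr_gt0.
  case: H => -[hq hd _ _].
    have h1 : q b * (q b * delta b) < q b * (q a * delta a) by rewrite ltr_pM2l.
    have h2 : q a * (q a * delta a) < q b * (q a * delta a) by rewrite ltr_pM2r.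
    have lt1 : q b * (q a * delta a) < 1 by rewrite -[X in _ < X]area ltrDr.
    by split; apply: lt_trans lt1.
  have h1 : q b * (q b * delta b) < q a * (q b * delta b) by rewrite ltr_pM2r.
  have h2 : q a * (q a * delta a) < q a * (q b * delta b) by rewrite ltr_pM2l.
  have lt1 : q a * (q b * delta b) < 1 by rewrite -[X in _ < X]area ltrDl.
  by split; apply: lt_trans lt1.
have da_db : delta a != delta b.
  case: H => -[_ _ nb na]; apply/eqP => E.
    by have := lt_le_trans nb na; rewrite E ltxx.
  by have := lt_le_trans na nb; rewrite E ltxx.
have [nE oneE] := crossing_point n%:R (q0 a) (q0 b) da_db; rewrite -/x0 -/y0 in nE oneE.
have [x00 y00] : 0 <= x0 /\ 0 <= y0.
  case: H => -[_ _ nb na].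
    have dlt : delta b < delta a by rewrite -(ltr_pM2l n0) (lt_le_trans nb na).
    split; first by rewrite divr_ge0 ?mulr_ge0 ?subr_ge0 // ltW.
    by rewrite mulr_le0 ?subr_le0 // invr_le0 mulr_ge0_le0 ?subr_le0 // ltW.
  have dlt : delta a < delta b by rewrite -(ltr_pM2l n0) (lt_le_trans na nb).
  split; last by rewrite divr_ge0 ?mulr_ge0 ?subr_ge0 // ltW.
  by rewrite mulr_le0 ?subr_le0 // invr_le0 mulr_ge0_le0 ?subr_le0 // ltW.
have qa0 := q0 a; have qb0 := q0 b; have a0 := gap0 a; have b0 := gap0 b.
rewrite aE bE !qE in nE oneE a0 b0 qa0 qb0.
split=> k k0 kle; (apply: estimate_lt; [reflexivity| by []|]).
  rewrite bE qE.
  case: H => -[hq hd _ _]; rewrite aE bE !qE in hq hd.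
    exact: (row_estimate_low alpha_irr ab_det qa0 b0 x00 nE oneE hq hd k0 kle).
  exact: (row_estimate_steep alpha_irr ab_det qb0 a0 x00 nE oneE hq hd k0 kle).
rewrite aE qE.
case: H => -[hq hd _ _]; rewrite aE bE !qE in hq hd.
  exact: (col_estimate_low alpha_irr ab_det qa0 b0 y00 nE oneE hq hd k0 kle).
exact: (col_estimate_steep alpha_irr ab_det qb0 a0 y00 nE oneE hq hd k0 kle).
Qed.
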